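(* Let $\tau$ be a nontrivial type and let $\tau=\rho_1\rho_2\cdots\rho_t$ be its (unique) factorisation into irreducible types. Suppose that the block decomposition of $\rho_i$ has $b_i$ blocks for $i\in[t]$, and set $b^*=\max(b_1,\dots,b_t)$. Then, as $n\to\infty$, \[ \chi\bigl( G(n,\tau)\bigr)= \Theta\bigl(\log_{(b^*-2)}(n)\bigr)\,. \]
   Context: For finite sets $X,Y\subseteq\mathbb{Q}$ with $X\cup Y=\{z_1<z_2<\dots<z_\ell\}$, the order type $\tau(X,Y)$ is the sequence $(\tau_1,\dots,\tau_\ell)$ with $\tau_i=1$ if $z_i\in X\setminus Y$, $\tau_i=2$ if $z_i\in Y\setminus X$, and $\tau_i=3$ if $z_i\in X\cap Y$. A type of width $k$ and length $\ell$ is the order type of a pair $(X,Y)$ with $|X|=|Y|=k$ and $|X\cup Y|=\ell$; the empty sequence is the empty type. A type is trivial if all its entries equal $3$. Juxtaposition denotes concatenation of sequences. A nonempty type is irreducible if it cannot be written as the concatenation of two nonempty types; every nonempty type factors uniquely as a concatenation of irreducible types. For a finite sequence $B$ of ones, twos and threes, $\mathbf{1}(B)$ denotes the number of entries equal to $1$ or $3$, and $\mathbf{2}(B)$ the number of entries equal to $2$ or $3$. The trivial irreducible type $3$ has exactly one block. A nontrivial irreducible type starts with $1$ (primary) or $2$ (secondary). Block decomposition of a primary irreducible type $\rho$: the first block $B_1$ consists of all initial ones of $\rho$; once $B_i$ is constructed, $B_{i+1}$ consists of the next consecutive entries of $\rho$ such that $\mathbf{2}(B_{i+1})=\mathbf{1}(B_i)$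 and, subject to this, $B_{i+1}$ is as long as possible; one stops when all entries are placed, giving $\rho=B_1\cdots B_b$ with $b$ blocks. For a secondary irreducible type, interchange ones and twos, decompose, and interchange back (same number of blocks). For a nontrivial type $\tau$ of width $k$ and $n\ge k$, the type-graph $G(n,\tau)$ has vertex set $\binom{[n]}{k}$, with $X,Y$ adjacent iff $\tau(X,Y)=\tau$ or $\tau(Y,X)=\tau$. $\log_{(t)}$ denotes the $t$-fold iterated base-$2$ logarithm, with $\log_{(0)}(n)=n$. *)

(* Defs.v *)
From mathcomp Require Import all_boot all_order all_algebra.
From mathcomp Require Import finmap.
From mathcomp Require Import all_classical all_reals all_analysis.
Set Implicit Arguments.
Unset Strict Implicit.
Unset Printing Implicit Defensive.
Import Order.TTheory GRing.Theory Num.Theory.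
Import numFieldNormedType.Exports.

Local Open Scope fset_scope.

Definition order_type d (T : orderType d) (X Y : {fset T}) : seq nat :=
  [seq if z \in X then (if z \in Y then 3 else 1) else 2
     | z <- sort <=%O (X `|` Y)].

Definition is_type_of (k l : nat) (s : seq nat) : Prop :=
  exists X Y : {fset rat},
    [/\ #|` X| = k, #|` Y| = k, #|` (X `|` Y)| = l & order_type X Y = s].

Definition is_type (s : seq nat) : Prop := exists k l, is_type_of k l s.

Definition trivial_type (s : seq nat) : bool := all (pred1 3) s.

Definition irreducible_type (s : seq nat) : Prop :=
  [/\ is_type s, s <> [::] &
      forall s1 s2, is_type s1 -> is_type s2 -> s1 <> [::] -> s2 <> [::] ->
        s <> s1 ++ s2].

Definition ones (B : seq nat) : nat := count [pred x | (x == 1) || (x == 3)] B.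
Definition twos (B : seq nat) : nat := count [pred x | (x == 2) || (x == 3)] B.

(* The prefixes are listed by increasing length, so [last] picks the longest. *)
Definition next_block (m : nat) (s : seq nat) : seq nat :=
  last [::] [seq B <- [seq take j s | j <- iota 0 (size s).+1] | twos B == m].

(* [fuel] only ensures termination: for irreducible types all blocks are
   nonempty, so [size s] is enough. *)
Fixpoint next_blocks (fuel m : nat) (s : seq nat) : seq (seq nat) :=
  match fuel, s with
  | f.+1, _ :: _ =>
      let B := next_block m s in B :: next_blocks f (ones B) (drop (size B) s)
  | _, _ => [::]
  end.

Definition primary_blocks (s : seq nat) : seq (seq nat) :=
  let B1 := take (find (predC1 1) s) s in
  B1 :: next_blocks (size s) (ones B1) (drop (size B1) s).

Definition swap12 (x : nat) : nat :=
  if x == 1 then 2 else if x == 2 then 1 else x.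

(* An irreducible type starting with neither 1 nor 2 is the type 3. *)
Definition blocks (s : seq nat) : seq (seq nat) :=
  match head 0 s with
  | 1 => primary_blocks s
  | 2 => map (map swap12) (primary_blocks (map swap12 s))
  | _ => [:: s]
  end.

Definition nblocks (s : seq nat) : nat := size (blocks s).

Record sgraph := SGraph {
  vertex :> finType;
  adj : rel vertex;
  adj_sym : symmetric adj;
  adj_irr : irreflexive adj }.

Definition colorable (G : sgraph) (c : nat) : bool :=
  [exists f : {ffun G -> 'I_c}, forall x, forall y, adj x y ==> (f x != f y)].

Lemma colorable_card (G : sgraph) : exists c, colorable G c.
Proof.
exists #|G|; apply/existsP; exists [ffun x => enum_rank x].
apply/forallP => x; apply/forallP => y; apply/implyP => xy.
rewrite !ffunE; apply: contraTneq xy => /enum_rank_inj ->.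
by rewrite adj_irr.
Qed.

Definition chromatic_number (G : sgraph) : nat := ex_minn (colorable_card G).

Definition ksubsets (n k : nat) : {fset {fset nat}} :=
  [fset X in fpowerset [fset i in iota 1 n] | #|` X| == k].

Definition type_adj (n k : nat) (tau : seq nat) : rel (ksubsets n k) :=
  fun X Y => (order_type (val X) (val Y) == tau)
          || (order_type (val Y) (val X) == tau).

Lemma type_adj_sym n k tau : symmetric (@type_adj n k tau).
Proof. by move=> X Y; rewrite /type_adj orbC. Qed.

Lemma type_adj_irr n k tau :
  ~~ trivial_type tau -> irreflexive (@type_adj n k tau).
Proof.
move=> tauN X; rewrite /type_adj orbb; apply: contraNF tauN => /eqP <-.
apply/allP => _ /mapP[z + ->]; rewrite fsetUid mem_sort => zX /=.
by rewrite (zX : z \in val X).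
Qed.

Definition type_graph (n k : nat) (tau : seq nat)
    (tauN : ~~ trivial_type tau) : sgraph :=
  SGraph (@type_adj_sym n k tau) (type_adj_irr tauN).

Local Open Scope ring_scope.

Definition log2 (R : realType) (x : R) : R := ln x / ln 2.

(* Meaningful for large arguments only: [ln x = 0] for [x <= 0]. *)
Definition iter_log (R : realType) (t : nat) (x : R) : R := iter t (@log2 R) x.

(* Main.v *)
Require Import Defs.
From mathcomp Require Import all_boot all_order all_algebra.
From mathcomp Require Import finmap.
From mathcomp Require Import zify lra.
From mathcomp Require Import all_classical all_reals all_analysis.
Import Order.TTheory GRing.Theory Num.Theory.
Import numFieldNormedType.Exports.

(** Put [m = b* - 2].

    Upper bound.  It suffices to use one factor with [b*] blocks, primary up to
    exchanging [X] and [Y].  If [x] and [y] enumerate the parts of [X] and [Y]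
    realising that factor and [s i] is the index of the first [X]-element of the
    [i]-th block, then [x_j < y_j], [x_(j+1) <= y_j] and
    [y_(s i) <= x_(s (i+1))] for [i < m].  Such interlacing chains in [0, N) can
    be coloured with [O(log_(m) N)] colours by induction on [m].  Let [h_q] be
    the top binary digit where [x_q] and the last point [x_T] of the chain
    differ, and sort the chains into finitely many classes according to the
    places where the nonincreasing sequence [h] drops.  Inside a class where [h]
    drops before [s (m-1)], the sequences [- h_q], [q <= s (m-1)], again satisfy
    the three systems of inequalities, with [m-1] in place of [m] and [log N] in
    place of [N]; in the other classes this holds for the chains reversed by
    [a |-> N-1-a].

    Lower bound.  The shift graph, in which [u_0 < .. < u_m] is joined to
    [u_1 < .. < u_(m+1)], maps homomorphically to the type-graph: the elements
    of the [i]-th block of a factor are put close to [u_i], at offsets which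
    make two consecutive blocks interleave as prescribed.  A colouring of the
    shift graph on [(m+1)]-tuples with [c] colours induces one on [m]-tuples
    with [2 ^ c] colours. *)

Set Implicit Arguments.
Unset Strict Implicit.
Unset Printing Implicit Defensive.

(** * Colouring interlacing chains *)

(* [s i] stands for the index of the first element of the [i]-th block, and
   [T = s m] for the last relevant index. *)
Definition chain_edge (m T : nat) (s x y : nat -> nat) : Prop :=
  [/\ forall j, j <= T -> x j < y j,
      forall j, j < T -> x j.+1 <= y j &
      forall i, i < m -> y (s i) <= x (s i.+1)].

Definition bounded_chain (T N : nat) (x : nat -> nat) : Prop :=
  (forall j, j < T -> x j <= x j.+1) /\ x T < N.

Lemma steps_mono (T : nat) (x : nat -> nat) :
  (forall j, j < T -> x j <= x j.+1) ->
  forall i j, i <= j -> j <= T -> x i <= x j.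
Proof.
move=> xS i; elim=> [|j IH] ij jT; first by move: ij; rewrite leqn0 => /eqP->.
move: ij; rewrite leq_eqVlt => /orP[/eqP->//|ij].
exact: leq_trans (IH ij (ltnW jT)) (xS _ jT).
Qed.

Section DropStep.
(** Kept abstract because the step is applied to [split_level] and, for the reversed chains, to its
    reflection [d2]. *)
Variable delta : nat -> nat -> nat.
Hypothesis deltaM : forall a b c, a <= b -> b <= c ->
  delta a c = maxn (delta a b) (delta b c).

Lemma delta_sub a b c d : a <= b -> b <= c -> c <= d -> delta b c <= delta a d.
Proof.
move=> ab bc cd; rewrite (deltaM ab (leq_trans bc cd)) (deltaM bc cd); lia.
Qed.

Definition tail_level (T : nat) (x : nat -> nat) (q : nat) := delta (x q) (x T).

(** A finite function, so that it can be a component of a colour, with [2 ^ T] values. *)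
Definition drops (T : nat) (x : nat -> nat) : {ffun 'I_T -> bool} :=
  [ffun j : 'I_T => tail_level T x j.+1 != tail_level T x j].

Lemma tail_level_step T N x : bounded_chain T N x -> forall j, j < T ->
  tail_level T x j = maxn (delta (x j) (x j.+1)) (tail_level T x j.+1).
Proof.
move=> [xS _] j jT; apply: deltaM; first exact: xS.
exact: (steps_mono xS).
Qed.

Lemma tail_level_chain T N L x T' : T' <= T -> bounded_chain T N x ->
  bounded_chain T' L.+1 (fun q => L - tail_level T x q).
Proof.
move=> T'T xC; split=> [j jT'|]; last by rewrite ltnS leq_subr.
by apply: leq_sub2l; rewrite (tail_level_step xC (leq_trans jT' T'T)) leq_maxr.
Qed.

Lemma eq_drops T x y : drops T x = drops T y -> forall j, j < T ->
  (tail_level T x j.+1 != tail_level T x j)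
  = (tail_level T y j.+1 != tail_level T y j).
Proof. by move=> /ffunP E j jT; have := E (Ordinal jT); rewrite !ffunE. Qed.

(* Where [h = tail_level T x] drops, the gap [(y_j, y_(j+1)]] carries the level
   [h' j = tail_level T y j] and lies inside [(x_(j+1), x_T]], so
   [h' j <= h (j+1)]; the first drop thus gives [h' 0 < h 0], and the strict
   inequality propagates to the right. *)
Lemma chain_edge_drop m T N L s x y :
  (forall i, i < m.+1 -> s i <= s i.+1) -> s m.+1 = T ->
  bounded_chain T N x -> bounded_chain T N y -> chain_edge m.+1 T s x y ->
  drops T x = drops T y ->
  tail_level T x (s m) < tail_level T x 0 ->
  (forall q, q <= T -> tail_level T x q <= L) ->
  chain_edge m (s m) s (fun q => L - tail_level T x q)
    (fun q => L - tail_level T y q).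
Proof.
move=> sS sT xC yC [A P Q] /eq_drops E dr hL.
have smT : s m <= T by rewrite -sT sS.
have xle := steps_mono xC.1; have yle := steps_mono yC.1.
set h := tail_level T x in E dr hL *; set h' := tail_level T y in E *.
have hS j : j < T -> h j = maxn (delta (x j) (x j.+1)) (h j.+1).
  exact: tail_level_step xC j.
have h'S j : j < T -> h' j = maxn (delta (y j) (y j.+1)) (h' j.+1).
  exact: tail_level_step yC j.
have key j : j < s m -> h' j.+1 != h' j -> h' j <= h j.+1.
  move=> jm dj; have jT : j < T by lia.
  have -> : h' j = delta (y j) (y j.+1) by move: dj (h'S j jT); lia.
  apply: delta_sub; [exact: P | exact: yC.1 |].
  apply: leq_trans (yle j.+1 (s m) _ _) _ => //.
  by have := Q m (ltnSn m); rewrite sT.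
(* Otherwise a first drop at [j < s m] would give [h' j <= h (j+1) < h j = h 0 <= h' 0 = h' j]. So
   [h] would be constant up to [s m], against [dr]. *)
have A0 : h' 0 < h 0.
  rewrite ltnNge; apply/negP => h0.
  have stay j : j <= s m -> h j = h 0 /\ h' j = h' 0.
    elim: j => // j IH jm; have [hj h'j] := IH (ltnW jm).
    have jT : j < T by lia.
    case: (boolP (h' j.+1 != h' j)) => dj; last by move: dj (E j jT); lia.
    by move: dj (key j jm dj) (hS j jT) (E j jT); lia.
  by have [] := stay (s m) (leqnn _); lia.
have A' j : j <= s m -> h' j < h j.
  elim: j => // j IH jm; have jT : j < T by lia.
  case: (boolP (h' j.+1 != h' j)) => dj.
    by move: dj (key j jm dj) (h'S j jT); lia.
  by move: dj (IH (ltnW jm)) (E j jT); lia.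
split=> [j jm|j jm|i im].
- by move: (A' j jm) (hL j (leq_trans jm smT)); lia.
- apply: leq_sub2l; have jT : j < T by lia.
  case: (boolP (h' j.+1 != h' j)) => dj; first exact: key.
  by move: dj (A' j (ltnW jm)) (E j jT); lia.
(* The interval from [x (s i.+1)] to [x T] lies inside the one from [y (s i)] to [y T]. *)
- apply: leq_sub2l; apply: delta_sub.
  + by apply: Q; lia.
  + apply: xle => //; apply: leq_trans smT; apply: (@steps_mono m s) => //.
    by move=> j jm; apply: sS; lia.
  + exact/ltnW/A.
Qed.

End DropStep.

Section Mirror.
Variables N T : nat.

Definition mirror (x : nat -> nat) (j : nat) : nat := N.-1 - x (T - j).

Lemma mirror_chain x : bounded_chain T N x -> bounded_chain T N (mirror x).
Proof.
move=> [xS xT]; split=> [j jT|]; rewrite /mirror; last by lia.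
apply: leq_sub2l; have -> : T - j = (T - j.+1).+1 by lia.
by apply: xS; lia.
Qed.

(** Reflection reverses every inequality, so the two chains exchange their roles. *)
Lemma mirror_edge m s x y :
  (forall i, i <= m -> s i <= T) ->
  bounded_chain T N x -> bounded_chain T N y -> chain_edge m T s x y ->
  chain_edge m T (fun i => T - s (m - i)) (mirror y) (mirror x).
Proof.
move=> sT xC yC [A P Q]; rewrite /mirror.
have yN j : j <= T -> y j < N.
  by move=> jT; apply: leq_ltn_trans yC.2; apply: (steps_mono yC.1).
split=> [j jT|j jT|i im].
- by have := A (T - j) (leq_subr _ _); have := yN (T - j) (leq_subr _ _); lia.
- apply: leq_sub2l; have -> : T - j = (T - j.+1).+1 by lia.
  by apply: P; lia.
- rewrite !subKn ?sT ?leq_subr //; apply: leq_sub2l.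
  have -> : m - i = (m - i.+1).+1 by lia.
  by apply: Q; lia.
Qed.

End Mirror.

(* The least [e] such that [a] and [b] lie in the same dyadic interval of
   length [2 ^ e]; it is the number of the top binary digit where they differ. *)
Lemma split_level_ex a b : exists e, a %/ 2 ^ e == b %/ 2 ^ e.
Proof.
exists (a + b); rewrite !divn_small //.
  by apply: leq_ltn_trans (ltn_expl (a + b) (ltnSn 1)); rewrite leq_addl.
by apply: leq_ltn_trans (ltn_expl (a + b) (ltnSn 1)); rewrite leq_addr.
Qed.

Definition split_level (a b : nat) : nat := ex_minn (split_level_ex a b).

Lemma split_level_le a b e : (split_level a b <= e) = (a %/ 2 ^ e == b %/ 2 ^ e).
Proof.
rewrite /split_level; case: ex_minnP => f /eqP ab minf.
apply/idP/idP => [fe|]; last exact: minf.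
by rewrite -(subnKC fe) expnD !divnMA ab.
Qed.

(** Dyadic intervals are convex, so one that contains [a] and [c] contains [b]; the two sides have
    the same upper bounds. *)
Lemma split_levelM a b c : a <= b -> b <= c ->
  split_level a c = maxn (split_level a b) (split_level b c).
Proof.
move=> ab bc; have E e : (split_level a c <= e)
    = (maxn (split_level a b) (split_level b c) <= e).
  rewrite geq_max !split_level_le.
  by move: (leq_div2r (2 ^ e) ab) (leq_div2r (2 ^ e) bc); lia.
by apply/eqP; rewrite eqn_leq E leqnn -E leqnn.
Qed.

(** At a common level [e + 1] the three points would share a dyadic interval of length [2 ^ (e + 1)]
    and lie in three different halves of it. *)
Lemma split_level_neq a b c : a <= b -> b <= c -> 0 < split_level a b ->
  split_level a b <> split_level b c.
Proof.
move=> ab bc; case E : (split_level a b) => [//|e] _ /esym E'.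
have := split_level_le a b e; have := split_level_le b c e.
have := split_level_le a b e.+1; have := split_level_le b c e.+1.
rewrite E E' !leqnn ltnn !expnSr !divnMA => /esym/eqP X /esym/eqP Y /esym Z /esym W.
move: (leq_div2r (2 ^ e) ab) (leq_div2r (2 ^ e) bc) X Y Z W.
by lia.
Qed.

Lemma split_levelxx a : split_level a a = 0.
Proof. by apply/eqP; rewrite -leqn0 split_level_le. Qed.

Lemma split_level_gt0 a b : a < b -> 0 < split_level a b.
Proof. by move=> ab; rewrite ltnNge split_level_le !divn1; lia. Qed.

Lemma split_level_bound a b N : a <= b -> b < N -> split_level a b <= up_log 2 N.
Proof.
move=> ab bN; have NL := up_logP N (ltnSn 1).
by rewrite split_level_le !divn_small //; lia.
Qed.

(* If both levels were equal, the gap carrying the level in [x] and the one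
   carrying it in [y] would be disjoint, which contradicts [split_level_neq]. *)
Lemma chain_edge1_neq T N s x y :
  s 0 = 0 -> s 1 = T ->
  bounded_chain T N x -> bounded_chain T N y -> chain_edge 1 T s x y ->
  drops split_level T x = drops split_level T y ->
  tail_level split_level T x 0 <> tail_level split_level T y 0.
Proof.
move=> s0 s1 xC yC [A P Q] /eq_drops E.
have xle := steps_mono xC.1; have yle := steps_mono yC.1.
have hS := tail_level_step split_levelM xC.
have h'S := tail_level_step split_levelM yC.
have hx q : tail_level split_level T x q = split_level (x q) (x T) by [].
have hy q : tail_level split_level T y q = split_level (y q) (y T) by [].
set h := tail_level split_level T x in E hS hx *.
set h' := tail_level split_level T y in E h'S hy *.
have yx : y 0 <= x T by have := Q 0 isT; rewrite s0 s1.
move=> hh; have hT : h T = 0 by rewrite hx split_levelxx.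
have h0 : 0 < h 0.
  by rewrite hx; apply/split_level_gt0/(leq_trans (A 0 _)).
(* There is no drop at all: at the first one, the gaps after [x j] and after [y j] would both have
   level [h 0]. But constancy contradicts [h T = 0 < h 0]. *)
have stay j : j <= T -> h j = h 0 /\ h' j = h' 0.
  elim: j => // j IH jT; have [hj h'j] := IH (ltnW jT).
  case: (boolP (h' j.+1 != h' j)) => dj; last by move: dj (E j jT); lia.
  exfalso.
  have e1 : split_level (x j) (x j.+1) = h 0.
    by move: dj (hS j jT) (E j jT); lia.
  have e2 : split_level (y j) (y j.+1) = h 0 by move: dj (h'S j jT); lia.
  have xj := xC.1 j jT; have yj := yC.1 j jT; have xy := P j jT.
  have M1 := split_levelM xj xy.
  have M2 := split_levelM (leq_trans xj xy) yj.
  (* The whole range from [x 0] to [y T] has level [h 0], since [y 0 <= x T] bounds the level of its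
     part beyond [x T] by [h' 0]. Hence the adjacent intervals from [x j] to [y j] and from [y j] to
     [y j.+1] both have exactly this level. *)
  have M3 : split_level (x 0) (y T) = maxn (h 0) (split_level (x T) (y T)).
    by apply: split_levelM; [apply: xle | apply/ltnW/A].
  have M4 : split_level (x T) (y T) <= h' 0.
    by apply: (delta_sub split_levelM) => //; apply/ltnW/A.
  have M5 : split_level (x j) (y j.+1) <= split_level (x 0) (y T).
    apply: (delta_sub split_levelM); [apply: xle|lia|exact: yle]; lia.
  apply: (@split_level_neq (x j) (y j) (y j.+1)); lia.
by have [] := stay T (leqnn _); lia.
Qed.

(** The bound [K] stays fixed while [T] shrinks in the induction. The case [m = 1] is separate
    because no drop can precede [s 0 = 0]. Each further step costs two drop patterns and a factor 2
    for the disjoint sum of two palettes. *)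
Lemma chain_coloring K m T N s :
  s 0 = 0 -> s m = T -> (forall i, i < m -> s i <= s i.+1) -> T <= K ->
  exists (C : finType) (f : (nat -> nat) -> C),
    #|C| <= (2 ^ K.*2.+1) ^ m * (iter m (fun a => (up_log 2 a).+1) N).+1
    /\ forall x y, bounded_chain T N x -> bounded_chain T N y ->
         chain_edge m T s x y -> f x <> f y.
Proof.
elim: m T N s => [|[_|m IH]] T N s s0 sT sS TK.
- exists 'I_N.+1, (fun x => inord (x T)); split; first by rewrite card_ord mul1n.
  move=> x y [_ xT] [_ yT] [A _ _] /(congr1 (@nat_of_ord _)).
  by rewrite !inordK 1?ltnW //; have := A T (leqnn _); lia.
- pose L := up_log 2 N.
  exists ({ffun 'I_T -> bool} * 'I_L.+1)%type,
    (fun x => (drops split_level T x, inord (tail_level split_level T x 0))).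
  split=> [|x y xC yC xy [dd hh]].
    rewrite card_prod card_ffun card_bool !card_ord /= expn1 leq_mul //.
      by rewrite leq_exp2l //; lia.
  apply: (chain_edge1_neq s0 sT xC yC xy dd).
  have bd z : bounded_chain T N z -> tail_level split_level T z 0 < L.+1.
    by case=> zS zT; apply: split_level_bound => //; apply: (steps_mono zS).
  by move/(congr1 (@nat_of_ord _)): hh; rewrite !inordK ?bd.
have smono i j : i <= j -> j <= m.+2 -> s i <= s j by apply: steps_mono.
pose L := up_log 2 N; pose s' i := T - s (m.+2 - i).
have sT' i : i <= m.+2 -> s i <= T by move=> im; rewrite -sT; apply: smono.
have [C1 [f1 [c1 f1P]]] : exists (C : finType) (f : (nat -> nat) -> C),
    #|C| <= (2 ^ K.*2.+1) ^ m.+1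
             * (iter m.+1 (fun a => (up_log 2 a).+1) L.+1).+1
    /\ forall x y, bounded_chain (s m.+1) L.+1 x ->
         bounded_chain (s m.+1) L.+1 y ->
         chain_edge m.+1 (s m.+1) s x y -> f x <> f y.
  apply: IH => //; first by move=> i im; apply: sS; lia.
  by apply: leq_trans TK; apply: sT'.
have [C2 [f2 [c2 f2P]]] : exists (C : finType) (f : (nat -> nat) -> C),
    #|C| <= (2 ^ K.*2.+1) ^ m.+1
             * (iter m.+1 (fun a => (up_log 2 a).+1) L.+1).+1
    /\ forall x y, bounded_chain (s' m.+1) L.+1 x ->
         bounded_chain (s' m.+1) L.+1 y ->
         chain_edge m.+1 (s' m.+1) s' x y -> f x <> f y.
  apply: IH => //; first by rewrite /s' subn0 sT subnn.
    by move=> i im; rewrite /s' leq_sub2l //; apply: smono; lia.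
  by apply: leq_trans TK; apply: leq_subr.
(* With [d2], the levels [g] of the reflected chain are those between the first point of the
   original chain and its other points ([gE]). *)
pose d2 a b := split_level (N.-1 - b) (N.-1 - a).
have d2M a b c : a <= b -> b <= c -> d2 a c = maxn (d2 a b) (d2 b c).
  by move=> ab bc; rewrite /d2 maxnC; apply: split_levelM; apply: leq_sub2l.
pose h x := tail_level split_level T x.
pose g x := tail_level d2 T (mirror N T x).
exists ({ffun 'I_T -> bool} * {ffun 'I_T -> bool} * (C1 + C2))%type.
exists (fun x => (drops split_level T x, drops d2 T (mirror N T x),
   if h x (s m.+1) < h x 0 then inl (f1 (fun q => L - h x q))
   else inr (f2 (fun q => L - g x q)))).
split=> [|x y xC yC xy].
  rewrite !card_prod card_sum !card_ffun card_bool card_ord.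
  rewrite expnS [iter m.+2 _ N]iterSr -/L.
  set G := iter m.+1 _ L.+1 in c1 c2 *; set E := _ ^ m.+1 in c1 c2 *.
  have -> : 2 ^ K.*2.+1 * E * G.+1 = 2 ^ K * 2 ^ K * (2 * (E * G.+1)).
    by rewrite expnS -addnn expnD; lia.
  have T2 : 2 ^ T <= 2 ^ K by rewrite leq_exp2l.
  by apply: leq_mul; [apply: leq_mul | rewrite mul2n -addnn leq_add].
case=> dd dd2.
case: ifP => hx; case: ifP => hy // [].
  apply: f1P.
  - exact: (tail_level_chain split_levelM L (sT' _ _) xC).
  - exact: (tail_level_chain split_levelM L (sT' _ _) yC).
  apply: (chain_edge_drop split_levelM _ sT xC yC xy dd hx) => //.
  move=> q qT; apply: split_level_bound; last exact: xC.2.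
  exact: (steps_mono xC.1).
have mxC := mirror_chain xC; have myC := mirror_chain yC.
have myx := mirror_edge sT' xC yC xy.
move=> E; symmetry in E; move: E; apply: f2P.
- exact: (tail_level_chain d2M L (leq_subr _ _) myC).
- exact: (tail_level_chain d2M L (leq_subr _ _) mxC).
have gE q : q <= T -> g y q = split_level (y 0) (y (T - q)).
  move=> qT; rewrite /g /tail_level /d2 /mirror subnn !subKn //.
    by have := yC.2; have := steps_mono yC.1 (leq_subr q T) (leqnn _); lia.
  by have := yC.2; have := steps_mono yC.1 (leq0n T) (leqnn _); lia.
have gL q : q <= T -> g y q <= L.
  move=> qT; rewrite gE //; apply: split_level_bound.
    by apply: (steps_mono yC.1) => //; apply: leq_subr.
  by apply: leq_ltn_trans yC.2; apply: (steps_mono yC.1) => //; apply: leq_subr.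
have := @chain_edge_drop d2 d2M m.+1 T N L s' (mirror N T y) (mirror N T x).
apply=> //.
- by move=> i im; rewrite /s' leq_sub2l //; apply: smono; lia.
- by rewrite /s' subnn s0 subn0.
(* Without a drop of [g], the interval from [y 0] to [y (s 1)] would have the level of the whole
   chain. So would the one from [y (s 1)] to [y T], as [h] does not drop before [s m.+1 >= s 1];
   this contradicts [split_level_neq]. *)
rewrite -/(g y) !gE ?leq_subr // subn0 subKn ?sT' ?subSnn //.
have [A _ Q] := xy.
have yle := steps_mono yC.1.
have y0 : y 0 <= y (s 1) by apply: yle => //; apply: sT'.
have y1 : y (s 1) <= y T by apply: yle => //; apply: sT'.
have h0 : h y 0 <= h y (s m.+1) by move: hy; lia.
rewrite ltnNge; apply/negP => g0.
have M1 := split_levelM y0 y1.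
have M2 : h y (s m.+1) <= split_level (y (s 1)) (y T).
  apply: (delta_sub split_levelM) => //.
    by apply: yle; [apply: smono | apply: sT'].
  by apply: yle => //; apply: sT'.
have M3 : split_level (y (s 1)) (y T) <= h y 0.
  exact: (delta_sub split_levelM).
have y0T : y 0 < y (s 1).
  by have := Q 0 isT; have := A (s 1) (sT' 1 isT); rewrite s0; lia.
have := split_level_gt0 y0T.
have hy0 : h y 0 = split_level (y 0) (y T) by [].
by have := split_level_neq y0 y1; lia.
Qed.

(** * Order types as masks of the sorted union *)

Definition is1 : pred nat := [pred x | (x == 1) || (x == 3)].
Definition is2 : pred nat := [pred x | (x == 2) || (x == 3)].

(** Combinatorial form of [is_type], by [is_type_word] and [type_word_is_type]. *)
Definition type_word (s : seq nat) : bool :=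
  all [in [:: 1; 2; 3]] s && (ones s == twos s).

(** Here [z] stands for the sorted union. No order is imposed, so that the relation passes to
    concatenations, images and factors. *)
Definition realizes (T : Type) (s : seq nat) (z x y : seq T) : Prop :=
  [/\ size z = size s, mask (map is1 s) z = x & mask (map is2 s) z = y].

Lemma ones_count s : ones s = count id (map is1 s).
Proof. by rewrite count_map. Qed.

Lemma twos_count s : twos s = count id (map is2 s).
Proof. by rewrite count_map. Qed.

Lemma ones_cat s1 s2 : ones (s1 ++ s2) = ones s1 + ones s2.
Proof. exact: count_cat. Qed.

Lemma twos_cat s1 s2 : twos (s1 ++ s2) = twos s1 + twos s2.
Proof. exact: count_cat. Qed.

Section OrderType.
Context {d : Order.disp_t} {T : orderType d}.
Local Open Scope order_scope.
Local Open Scope fset_scope.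
Implicit Types (X Y : {fset T}) (z x y : seq T).

Lemma sort_fset_sorted X : sorted <%O (sort <=%O X).
Proof. by rewrite sort_lt_sorted fset_uniq. Qed.

Lemma sort_fset_eq X x : sorted <%O x -> X =i x -> sort <=%O X = x.
Proof.
move=> xs Xx; apply: (irr_sorted_eq lt_trans ltxx) => //.
  exact: sort_fset_sorted.
by move=> a; rewrite mem_sort.
Qed.

Lemma order_type_realizes X Y : exists2 z, sorted <%O z &
  all [in [:: 1; 2; 3]%N] (order_type X Y)
  /\ realizes (order_type X Y) z (sort <=%O X) (sort <=%O Y).
Proof.
exists (sort <=%O (X `|` Y)); first exact: sort_fset_sorted.
rewrite /order_type; set z := sort _ _.
have zs : sorted <%O z by exact: sort_fset_sorted.
have zE a : (a \in z) = (a \in X) || (a \in Y) by rewrite mem_sort in_fsetU.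
split; last split.
- by apply/allP => _ /mapP[a _ ->]; case: (a \in X); case: (a \in Y).
- by rewrite size_map.
- rewrite -map_comp -filter_mask; symmetry; apply: sort_fset_eq.
    exact: (sorted_filter lt_trans).
  move=> a; rewrite mem_filter zE /= /is1 /=.
  by case: (a \in X); case: (a \in Y).
- rewrite -map_comp -filter_mask; symmetry; apply: sort_fset_eq.
    exact: (sorted_filter lt_trans).
  move=> a; rewrite mem_filter zE /= /is2 /=.
  by case: (a \in X); case: (a \in Y).
Qed.

Lemma mem_realizes s z x y : uniq z -> all [in [:: 1; 2; 3]%N] s ->
  realizes s z x y ->
  s = [seq (if a \in x then (if a \in y then 3 else 1) else 2)%N | a <- z]
  /\ forall a, (a \in z) = (a \in x) || (a \in y).
Proof.
move=> + + [+ <- <-]; elim: s z => [|c s IH] [|b z] //= /andP[bz uz].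
move=> /andP[c123 s123] [sz]; have [E1 E2] := IH z uz s123 sz.
have N m : b \notin mask m z by apply: contra bz => /mem_mask.
have ne a : a \in z -> (a == b) = false by move=> az; apply: contraNF bz => /eqP<-.
move: c123; rewrite !inE => /or3P[]/eqP-> /=; rewrite ?inE ?eqxx ?(negPf (N _)) /=.
- split=> [|a]; last by rewrite !inE E2 orbA.
  congr cons; rewrite {1}E1; apply/eq_in_map => a /ne; rewrite inE => ->.
  by [].
- split=> [|a]; last by rewrite !inE E2 orbCA.
  congr cons; rewrite {1}E1; apply/eq_in_map => a /ne; rewrite inE => ->.
  by [].
- split=> [|a]; last by rewrite !inE E2; case: (a == b).
  congr cons; rewrite {1}E1; apply/eq_in_map => a /ne; rewrite !inE => ->.
  by [].
Qed.

Lemma realizes_order_type s X Y z : sorted <%O z ->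
  all [in [:: 1; 2; 3]%N] s -> realizes s z (sort <=%O X) (sort <=%O Y) ->
  order_type X Y = s.
Proof.
move=> zs s123 sz; have uz := lt_sorted_uniq zs.
have [-> E] := mem_realizes uz s123 sz.
rewrite /order_type (sort_fset_eq zs).
  by apply/eq_in_map => a _; rewrite !mem_sort.
by move=> a; rewrite in_fsetU E !mem_sort.
Qed.

(** Turns comparisons between elements of [X] and [Y] into comparisons of [ones] and [twos] on
    prefixes of the type. *)
Lemma nth_mask_lt (m : bitseq) z (x0 : T) p q : sorted <%O z -> size m = size z ->
  (p < size z)%N -> (q < count id m)%N ->
  (nth x0 (mask m z) q < nth x0 z p) = (q < count id (take p m))%N.
Proof.
elim: m z p q => [|b m IH] [|a z] //= p q.
rewrite (path_sortedE lt_trans) => /andP[/allP az sz] [smz].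
have mz m' i : (i < count id m')%N -> size m' = size z ->
    a < nth x0 (mask m' z) i.
  move=> im sm'; apply: az; apply: (@mem_mask _ _ m'); apply: mem_nth.
  by rewrite size_mask.
case: p => [_|p] /=.
  case: b => /=; last by move=> qm; apply/negbTE; rewrite -leNgt ltW ?mz.
  by case: q => [|q] /= qm; rewrite ?ltxx //; apply/negbTE; rewrite -leNgt ltW ?mz.
rewrite ltnS => pz; case: b => /=; last by move=> qm; rewrite add0n; apply: IH.
case: q => [|q] /=; first by move=> _; rewrite az ?mem_nth.
by rewrite !ltnS => qm; rewrite IH.
Qed.

Lemma nth_mask_le (m : bitseq) z (x0 : T) p q : sorted <%O z -> size m = size z ->
  (p < size z)%N -> (q < count id m)%N ->
  (nth x0 (mask m z) q <= nth x0 z p) = (q < count id (take p.+1 m))%N.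
Proof.
elim: m z p q => [|b m IH] [|a z] //= p q.
rewrite (path_sortedE lt_trans) => /andP[/allP az sz] [smz].
have mz m' i : (i < count id m')%N -> size m' = size z ->
    a < nth x0 (mask m' z) i.
  move=> im sm'; apply: az; apply: (@mem_mask _ _ m'); apply: mem_nth.
  by rewrite size_mask.
case: p => [_|p] /=.
  rewrite take0; case: b => /=; last by move=> qm; apply/negbTE; rewrite -ltNge mz.
  by case: q => [|q] /= qm; rewrite ?lexx //; apply/negbTE; rewrite -ltNge mz.
rewrite ltnS => pz; case: b => /=; last by move=> qm; rewrite add0n; apply: IH.
case: q => [|q] /=; first by move=> _; rewrite ltW ?az ?mem_nth.
by rewrite !ltnS => qm; rewrite IH.
Qed.

Lemma nth_mask_pos (m : bitseq) z (x0 : T) q : size m = size z ->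
  (q < count id m)%N -> exists p,
  [/\ (p < size z)%N, count id (take p m) = q, count id (take p.+1 m) = q.+1
    & nth x0 (mask m z) q = nth x0 z p].
Proof.
elim: m z q => [|b m IH] [|a z] //= q [smz].
case: b => /= [|qm].
  case: q => [|q]; first by exists 0%N; rewrite /= take0.
  by rewrite ltnS => qm; have [p [pz c1 c2 E]] := IH z q smz qm;
     exists p.+1; rewrite /= c1 c2.
by have [p [pz c1 c2 E]] := IH z q smz qm; exists p.+1; rewrite /= c1 c2.
Qed.

End OrderType.

(** * Irreducible types and their blocks *)

Lemma realizes_size (T : Type) s (z x y : seq T) :
  realizes s z x y -> size x = ones s /\ size y = twos s.
Proof.
by move=> [sz <- <-]; rewrite !size_mask ?size_map -?ones_count -?twos_count.
Qed.

Lemma order_type_fset d (T : orderType d) s (z x y : seq T) :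
  sorted <%O z -> all [in [:: 1; 2; 3]] s -> realizes s z x y ->
  order_type [fset a in x]%fset [fset a in y]%fset = s.
Proof.
move=> zs s123 r; apply: (realizes_order_type zs s123).
case: (r) => sz xE yE; rewrite (@sort_fset_eq _ _ _ x) ?(@sort_fset_eq _ _ _ y) //.
- by rewrite -yE; apply: sorted_mask => //; apply: lt_trans.
- by move=> a; rewrite in_fset.
- by rewrite -xE; apply: sorted_mask => //; apply: lt_trans.
- by move=> a; rewrite in_fset.
Qed.

Lemma card_fset_sorted d (T : orderType d) (x : seq T) :
  sorted <%O x -> #|` [fset a in x]%fset| = size x.
Proof. by move=> /lt_sorted_uniq ux; rewrite card_fseq undup_id. Qed.

Lemma is_type_word k l s : is_type_of k l s -> type_word s /\ ones s = k.
Proof.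
case=> X [Y [Xk Yk _ sE]]; have [z zs [s123 r]] := order_type_realizes X Y.
have [] := realizes_size r; rewrite !size_sort Xk Yk sE => kx ky.
by split; [rewrite /type_word -{1}sE s123 -kx -ky eqxx | rewrite -kx].
Qed.

Lemma type_word_is_type s : type_word s -> is_type s.
Proof.
move=> /andP[s123 /eqP s12].
pose z : seq rat := [seq i%:R%R | i <- iota 0 (size s)].
have zs : sorted <%O z.
  rewrite sorted_map; apply: (@sub_sorted _ ltn); last exact: iota_ltn_sorted.
  by move=> i j ij /=; rewrite Num.Theory.ltr_nat.
set x := mask (map is1 s) z; set y := mask (map is2 s) z.
have r : realizes s z x y by split; rewrite // size_map size_iota.
have [sx sy] := realizes_size r.
have := order_type_fset zs s123 r.
set X := [fset a in x]%fset; set Y := [fset a in y]%fset => sE.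
exists (ones s), #|` (X `|` Y)%fset|, X, Y; split=> //.
  by rewrite card_fset_sorted //; apply: sorted_mask => //; apply: lt_trans.
rewrite card_fset_sorted ?sy //; apply: sorted_mask => //; exact: lt_trans.
Qed.

(** A balanced proper prefix leaves a balanced suffix, and both would be types. *)
Lemma irreducible_prefix s : irreducible_type s -> type_word s /\
  forall j, 0 < j < size s -> ones (take j s) <> twos (take j s).
Proof.
case=> [[k [l /is_type_word[sw _]]] s0 irr]; split=> // j /andP[j0 js] E.
case/andP: sw => s123 /eqP; rewrite -(cat_take_drop j s) ones_cat twos_cat => E2.
move: s123; rewrite -{1}(cat_take_drop j s) all_cat => /andP[a1 a2].
apply: (irr (take j s) (drop j s)); last by rewrite cat_take_drop.
- by apply: type_word_is_type; rewrite /type_word a1 E eqxx.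
- apply: type_word_is_type; rewrite /type_word a2; apply/eqP; lia.
- by move=> /(congr1 size); rewrite size_take js /=; lia.
- by move=> /(congr1 size); rewrite size_drop /=; lia.
Qed.

Definition primary_word (s : seq nat) : Prop :=
  [/\ type_word s, head 0 s = 1 &
      forall j, 0 < j < size s -> twos (take j s) < ones (take j s)].

Lemma take_step s j : all [in [:: 1; 2; 3]] s -> j < size s ->
  twos (take j.+1 s) = twos (take j s) + is2 (nth 0 s j)
  /\ ones (take j.+1 s) = ones (take j s) + is1 (nth 0 s j).
Proof.
move=> s123 js; rewrite (take_nth 0 js) -cats1 ones_cat twos_cat /ones /twos /=.
by have /allP/(_ _ (mem_nth 0 js)) := s123; rewrite !inE => /or3P[]/eqP-> /=; lia.
Qed.

(* The walk [ones - twos] has steps [1], [0] and [-1], so it cannot change sign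
   without returning to [0]. *)
Lemma primary_irreducible s :
  irreducible_type s -> head 0 s = 1 -> primary_word s.
Proof.
move=> /irreducible_prefix[sw ne] h1; split=> //; case/andP: (sw) => s123 _.
elim=> // -[|j] IH /andP[_ js].
  by case: s h1 {sw ne s123 IH js} => //= c s ->; rewrite take0.
have := IH; rewrite (ltnW js) => /(_ isT) lt.
have := ne j.+2; rewrite js => /(_ isT).
have [-> ->] := take_step s123 (ltnW js).
by move: lt; case: (is1 _); case: (is2 _) => /=; lia.
Qed.

Lemma ones_swap s : ones (map swap12 s) = twos s.
Proof.
rewrite /ones /twos count_map; apply: eq_count => a /=; rewrite /swap12.
by case: (a =P 1) => [->//|a1]; case: (a =P 2) => [->//|a2]; rewrite (introF eqP a1).
Qed.

Lemma swap12K : involutive swap12.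
Proof.
move=> a; rewrite /swap12; case: (a =P 1) => [->//|/eqP/negPf a1].
by case: (a =P 2) => [->//|/eqP/negPf a2]; rewrite a1 a2.
Qed.

Lemma map_swap12K : involutive (map swap12).
Proof. exact/mapK/swap12K. Qed.

Lemma twos_swap s : twos (map swap12 s) = ones s.
Proof. by rewrite -{2}(map_swap12K s) ones_swap. Qed.

Lemma type_word_swap s : type_word s -> type_word (map swap12 s).
Proof.
move=> /andP[s123 /eqP E]; rewrite /type_word ones_swap twos_swap E eqxx andbT.
by rewrite all_map; apply: sub_all s123 => a; rewrite !inE => /or3P[]/eqP->.
Qed.

Lemma secondary_irreducible s :
  irreducible_type s -> head 0 s = 2 -> primary_word (map swap12 s).
Proof.
move=> /irreducible_prefix[sw ne] h2; case/andP: (sw) => s123 _.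
split; [exact: type_word_swap | by case: s h2 {sw ne s123} => //= c s -> |].
move=> j; rewrite size_map -map_take ones_swap twos_swap.
elim: j => // -[|j] IH /andP[_ js].
  by case: s h2 {sw ne s123 IH js} => //= c s ->; rewrite take0.
have := IH; rewrite (ltnW js) => /(_ isT) lt.
have := ne j.+2; rewrite js => /(_ isT).
have [-> ->] := take_step s123 (ltnW js).
by move: lt; case: (is1 _); case: (is2 _) => /=; lia.
Qed.

Lemma realizes_swap (T : Type) s (z x y : seq T) :
  all [in [:: 1; 2; 3]] s ->
  realizes (map swap12 s) z x y <-> realizes s z y x.
Proof.
move=> s123; rewrite /realizes size_map -!map_comp.
have -> : map (is1 \o swap12) s = map is2 s.
  by apply/eq_in_map => a /(allP s123); rewrite !inE => /or3P[]/eqP->.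
have -> : map (is2 \o swap12) s = map is1 s.
  by apply/eq_in_map => a /(allP s123); rewrite !inE => /or3P[]/eqP->.
by split=> -[? ? ?]; split.
Qed.

(** What the maximality of the preceding block yields. The default [0] makes it false on the empty
    block. *)
Definition starts2 (B : seq nat) : bool := is2 (head 0 B).

(** Apart from the number of blocks, this is all that is used of the decomposition. The [0] in
    [belast] says that the first block has no twos. *)
Definition block_chain (s : seq nat) (bs : seq (seq nat)) : Prop :=
  [/\ flatten bs = s, map twos bs = belast 0 (map ones bs),
      last 0 (map ones bs) = 0 & all starts2 (behead bs)].

Lemma last_filter_map (T : Type) (x0 : T) (f : nat -> T) (p : pred nat) n j0 :
  j0 <= n -> p j0 -> exists j, [/\ j <= n, p j,
    last x0 [seq f j | j <- [seq j <- iota 0 n.+1 | p j]] = f j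
    & forall i, j < i <= n -> ~~ p i].
Proof.
elim: n => [|n IH] jn pj.
  exists 0; move: jn; rewrite leqn0 => /eqP j0E; rewrite j0E in pj.
  by split=> //=; [rewrite pj | case].
have -> : iota 0 n.+2 = rcons (iota 0 n.+1) n.+1.
  by rewrite -[n.+2]addn1 iotaD cats1.
rewrite filter_rcons (fun_if (map f)) (fun_if (last x0)) map_rcons last_rcons.
case: ifP => pn.
  by exists n.+1; split=> // i /andP[n1 n2]; move: (leq_trans n1 n2); rewrite ltnn.
have [|j [jn' pj' E H]] := IH _ pj.
  by move: jn; rewrite leq_eqVlt => /orP[/eqP jE|//]; rewrite jE pn in pj.
exists j; split=> // [|i /andP[ji]]; first exact: leqW.
rewrite leq_eqVlt => /orP[/eqP->|in1]; first by rewrite pn.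
by apply: H; rewrite ji.
Qed.

(** Discrete intermediate values: each letter raises [twos] by at most one. *)
Lemma exists_twos_take m s : m <= twos s ->
  exists2 j, j <= size s & twos (take j s) = m.
Proof.
elim: s m => [|c s IH] m; first by rewrite leqn0 => /eqP->; exists 0.
rewrite -cat1s twos_cat; case: m => [|m] mc; first by exists 0.
have [|j js E] := IH (m.+1 - twos [:: c]); first lia.
exists j.+1 => //; have -> : take j.+1 ([:: c] ++ s) = [:: c] ++ take j s by [].
by rewrite twos_cat E; move: mc; rewrite /twos /=; lia.
Qed.

Lemma next_blockP m s : m <= twos s -> exists j, [/\ j <= size s,
  next_block m s = take j s, twos (take j s) = m
  & starts2 (drop j s) || (j == size s)].
Proof.
move=> /exists_twos_take[j0 j0s E0].
have [|j [js /eqP Ej L H]] := @last_filter_map _ [::] (take^~ s)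
  (fun j => twos (take j s) == m) (size s) j0 j0s; first exact/eqP.
exists j; split=> //; first by rewrite /next_block filter_map.
move: js; rewrite leq_eqVlt => /orP[->|js]; first by rewrite orbT.
apply/orP; left.
have := H j.+1; rewrite ltnSn js => /(_ isT).
rewrite (take_nth 0 js) -cats1 twos_cat Ej /starts2 (drop_nth 0 js) /=.
by rewrite /twos /is2 /=; case: (_ || _) => //=; rewrite !addn0 eqxx.
Qed.

(** As [m] counts the ones of the preceding block, [m + ones - twos] continues the walk
    [ones - twos] of the whole word. Its positivity before the end gives [0 < m], so the blocks are
    nonempty and the fuel suffices. *)
Lemma next_blocks_chain f m s : size s <= f -> starts2 s || (s == [::]) ->
  (forall j, j < size s -> twos (take j s) < m + ones (take j s)) ->
  twos s = m + ones s ->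
  [/\ flatten (next_blocks f m s) = s,
      map twos (next_blocks f m s) = belast m (map ones (next_blocks f m s)),
      last m (map ones (next_blocks f m s)) = 0 &
      all starts2 (next_blocks f m s)].
Proof.
elim: f m s => [|f IH] m [|c s] //;
  try by move=> _ _ _ E; split=> //=; move: E; rewrite /twos /ones /= addn0.
set t := c :: s => sf st lt E.
have -> : next_blocks f.+1 m t = next_block m t ::
    next_blocks f (ones (next_block m t)) (drop (size (next_block m t)) t) by [].
have [|j [jt jE tj sj]] := @next_blockP m t; first by rewrite E leq_addr.
have m0 : 0 < m by have := lt 0 isT; rewrite take0 /twos /ones /= addn0.
have j0 : 0 < j by case: (j) tj => //; rewrite take0 => m0'; rewrite -m0' in m0.
have sz : size (take j t) = j by rewrite size_takel.
rewrite jE sz.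
have tE : t = take j t ++ drop j t by rewrite cat_take_drop.
have [||i|| e1 e2 e3 e4] := IH (ones (take j t)) (drop j t).
- by move: sf; rewrite size_drop /=; lia.
- by case/orP: sj => [->//|/eqP->]; rewrite drop_size orbT.
- rewrite size_drop ltn_subRL => /lt; rewrite takeD ones_cat twos_cat tj.
  by rewrite ltn_add2l.
- by move: E; rewrite {1 2}tE ones_cat twos_cat tj; lia.
have st' : starts2 (take j t).
  by move: st; rewrite orbF /starts2 -!nth0 nth_take.
by split=> //=; [rewrite e1 cat_take_drop | rewrite e2 tj | rewrite st' e4].
Qed.

Lemma primary_block_chain s :
  primary_word s -> block_chain s (primary_blocks s) /\ 1 < size (primary_blocks s).
Proof.
move=> [/andP[s123 /eqP E] h1 lt].
rewrite /primary_blocks; set i := find _ s; set B := take i s.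
have is' : i <= size s by exact: find_size.
have sB : size B = i by rewrite size_takel.
have Ball a : a \in B -> a = 1.
  move=> /(nthP 0)[q]; rewrite sB => qi <-; rewrite nth_take //.
  by have /negbT := before_find 0 qi; rewrite negbK => /eqP.
have B2 : twos B = 0.
  by apply/eqP; rewrite -leqn0 leqNgt -has_count; apply/hasPn => a /Ball ->.
have i0 : 0 < i by rewrite /i; case: (s) h1 => //= c s' ->.
have B1 : 0 < ones B.
  rewrite -has_count; apply/hasP; exists (nth 0 B 0); first by rewrite mem_nth ?sB.
  by rewrite (Ball (nth 0 B 0)) ?mem_nth ?sB.
have [||j|| e1 e2 e3 e4] := @next_blocks_chain (size s) (ones B) (drop i s).
- by rewrite size_drop leq_subr.
- case: (ltngtP i (size s)) is' => // [is' _|-> _]; last first.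
    by rewrite drop_size orbT.
  apply/orP; left; have : has (predC1 1) s by rewrite has_find.
  move=> /(nth_find 0); rewrite -/i /= => n1.
  have /allP/(_ _ (mem_nth 0 is')) := s123.
  rewrite !inE (negPf n1) /= /starts2 (drop_nth 0 is') /=.
  by rewrite /is2 /=.
- rewrite size_drop => js; have := lt (i + j); rewrite takeD ones_cat twos_cat.
  rewrite -/B B2 addn_gt0 i0 -ltn_subRL js => /(_ isT).
  by rewrite add0n.
- have : ones B + ones (drop i s) = twos B + twos (drop i s).
    by rewrite -ones_cat -twos_cat cat_take_drop.
  by rewrite B2.
rewrite sB; split; first by split=> //=; [rewrite e1 cat_take_drop | rewrite B2 e2].
by rewrite /= ltnS lt0n size_eq0; apply/eqP => b0; move: e3 B1; rewrite b0 /= => ->.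
Qed.

Lemma ones_flatten bs : ones (flatten bs) = sumn (map ones bs).
Proof. by elim: bs => //= B bs <-; rewrite ones_cat. Qed.

Lemma twos_flatten bs : twos (flatten bs) = sumn (map twos bs).
Proof. by elim: bs => //= B bs <-; rewrite twos_cat. Qed.

Lemma twos_take_blocks s bs i : block_chain s bs -> i < size bs ->
  twos (flatten (take i.+1 bs)) = ones (flatten (take i bs)).
Proof.
move=> [_ E _ _] ib; rewrite twos_flatten ones_flatten !map_take E.
have take_belast (a : nat) l q : q <= size l ->
    take q (belast a l) = take q (a :: l).
  by elim: l a q => [|b l IH] a [|q] //= ql; rewrite IH.
by rewrite take_belast ?size_map.
Qed.

(** Index of the first [X]-element of block [i]; by [twos_take_blocks] also that of the first
    [Y]-element of block [i + 1]. *)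
Definition block_start (bs : seq (seq nat)) (i : nat) : nat :=
  ones (flatten (take i bs)).

Lemma block_start_mono bs i : block_start bs i <= block_start bs i.+1.
Proof.
rewrite /block_start; case: (ltnP i (size bs)) => ib; last first.
  by rewrite !take_oversize // ltnW.
by rewrite (take_nth [::] ib) -cats1 flatten_cat ones_cat leq_addr.
Qed.

Lemma block_chain_split s bs i : block_chain s bs -> i < size bs ->
  s = flatten (take i bs) ++ nth [::] bs i ++ flatten (drop i.+1 bs).
Proof.
move=> [<- _ _ _] ib; rewrite -{1}(cat_take_drop i bs) flatten_cat.
by rewrite (drop_nth [::] ib).
Qed.

(** The last block starts with a [Y]-element, so the block before it contains an [X]-element; thus
    the indices up to [T] are valid. *)
Lemma block_start_lt s bs m : block_chain s bs -> size bs = m.+2 ->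
  block_start bs m < ones s.
Proof.
move=> bc sb; have m1 : m.+1 < size bs by rewrite sb.
have m0 : m < size bs by exact: ltnW.
have := twos_take_blocks bc m1; have := twos_take_blocks bc m0.
rewrite (take_nth [::] m1) (take_nth [::] m0) -!cats1 !flatten_cat /= !cats0.
rewrite !twos_cat !ones_cat.
have st : starts2 (nth [::] bs m.+1).
  case: bc => _ _ _ /all_nthP -/(_ [::] m).
  by rewrite nth_behead size_behead sb; apply.
have : 0 < twos (nth [::] bs m.+1).
  by move: st; rewrite /starts2; case: nth => //= c B; rewrite /twos /is2 /= => ->.
rewrite (block_chain_split bc m0) !ones_cat -/(block_start bs m) /block_start.
lia.
Qed.

Section BlockEdge.
Context {d : Order.disp_t} {T : orderType d}.

(** The first two systems are the prefix inequality read just before and just after [y_j]. For the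
    third, the first entry of block [i + 1] is a [Y]-element, with index [s i], and no [X]-element
    of that block precedes it. *)
Lemma realizes_chain_edge (x0 : T) s bs m (z x y : seq T) (h : T -> nat) :
  {homo h : a b / (a < b)%O >-> a < b} ->
  primary_word s -> block_chain s bs -> size bs = m.+2 ->
  sorted <%O z -> realizes s z x y ->
  chain_edge m (block_start bs m) (block_start bs)
    (fun j => h (nth x0 x j)) (fun j => h (nth x0 y j)).
Proof.
move=> hlt [/andP[s123 /eqP E] h1 lt] bc sb zs [sz <- <-].
have hle a b : (a <= b)%O -> h a <= h b.
  by rewrite le_eqVlt => /orP[/eqP->//|/hlt/ltnW].
have Tk := block_start_lt bc sb.
have ones_take q : count id (take q (map is1 s)) = ones (take q s).
  by rewrite -map_take -ones_count.
have twos_take q : count id (take q (map is2 s)) = twos (take q s).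
  by rewrite -map_take -twos_count.
have sz1 : size (map is1 s) = size z by rewrite size_map.
have sz2 : size (map is2 s) = size z by rewrite size_map.
have bm i : i <= m -> block_start bs i <= block_start bs m.
  move=> im; apply: (@steps_mono m (block_start bs)) => // j _.
  exact: block_start_mono.
split=> [j jT|j jT|i im].
- have [|p [pz t1 t2 ->]] := @nth_mask_pos _ _ (map is2 s) z x0 j sz2.
    by rewrite -twos_count; lia.
  apply: hlt; rewrite nth_mask_lt //; last by rewrite -ones_count; lia.
  move: t1 t2; rewrite ones_take !twos_take => t1 t2.
  case: p pz t1 t2 => [|p] pz t1 t2; last by rewrite -{1}t1; apply: lt; rewrite -sz.
  (* The prefix is nonempty since the first letter is 1, which does not belong to [Y]. *)
  by exfalso; case: (s) h1 t1 t2 => //= c s' ->; rewrite take0 => <-.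
- have [|p [pz t1 t2 ->]] := @nth_mask_pos _ _ (map is2 s) z x0 j sz2.
    by rewrite -twos_count; lia.
  apply: hle; rewrite nth_mask_le //; last by rewrite -ones_count; lia.
  move: t1 t2; rewrite ones_take !twos_take => t1 t2.
  have := lt p.+1; rewrite t2; apply; rewrite /= ltn_neqAle -{2}sz pz andbT.
  by apply/eqP => ps; move: t2; rewrite ps take_size; lia.
- have ib : i.+1 < size bs by lia.
  set p := size (flatten (take i.+1 bs)).
  have sE := block_chain_split bc ib.
  have st : starts2 (nth [::] bs i.+1).
    case: bc => _ _ _ /all_nthP -/(_ [::] i); rewrite nth_behead size_behead sb.
    by apply; lia.
  have tp : take p s = flatten (take i.+1 bs) by rewrite sE take_size_cat.
  have [B0 pz n2] : [/\ 0 < size (nth [::] bs i.+1), p < size z & is2 (nth 0 s p)].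
    move: st; rewrite sz sE !size_cat /p nth_cat ltnn subnn.
    by rewrite /starts2; case: nth => //= c B ->; split=> //; lia.
  apply: (@leq_trans (h (nth x0 z p))); apply: hle.
    rewrite nth_mask_le ?twos_take //; last first.
      by rewrite -twos_count -E; apply: leq_ltn_trans Tk; apply: bm; apply: ltnW.
    have ps : p < size s by rewrite -sz.
    have [-> _] := take_step s123 ps.
    by rewrite n2 tp (twos_take_blocks bc) ?addn1 //; lia.
  rewrite leNgt nth_mask_lt ?ones_take //.
    by rewrite tp ltnn.
  rewrite -ones_count; apply: leq_ltn_trans Tk.
  exact: bm.
Qed.

End BlockEdge.

(** * Shift gadgets and the shift graph *)

Lemma realizes_cat (T : Type) s1 s2 (z1 x1 y1 z2 x2 y2 : seq T) :
  realizes s1 z1 x1 y1 -> realizes s2 z2 x2 y2 ->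
  realizes (s1 ++ s2) (z1 ++ z2) (x1 ++ x2) (y1 ++ y2).
Proof.
move=> [z1s <- <-] [z2s <- <-].
by split; rewrite ?size_cat ?z1s ?z2s // map_cat mask_cat ?size_map.
Qed.

Lemma realizes_map (T U : Type) (f : T -> U) s z x y :
  realizes s z x y -> realizes s (map f z) (map f x) (map f y).
Proof. by move=> [zs <- <-]; split; rewrite ?size_map ?map_mask. Qed.

Lemma realizes_take (T : Type) s1 s2 (z x y : seq T) :
  realizes (s1 ++ s2) z x y -> realizes s1 (take (size s1) z)
    (take (ones s1) x) (take (twos s1) y)
  /\ realizes s2 (drop (size s1) z) (drop (ones s1) x) (drop (twos s1) y).
Proof.
move=> [zs <- <-]; set n := size s1.
have n1 : size (take n z) = n by rewrite size_takel // zs size_cat leq_addr.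
have [m1 m2] : size (mask (map is1 s1) (take n z)) = ones s1
    /\ size (mask (map is2 s1) (take n z)) = twos s1.
  by rewrite !size_mask ?size_map -?ones_count -?twos_count.
rewrite -{2 3 5 6}(cat_take_drop n z) !map_cat !mask_cat ?size_map //.
rewrite !take_size_cat // !drop_size_cat //.
by split; split; rewrite // size_drop zs size_cat addKn.
Qed.

Section Fits.
Context {d : Order.disp_t} {T : orderType d}.

(* [ths] lists the offsets of the entries of the blocks [bs]; the [j]-th element
   of [X] and that of [Y] must have the same offset, although they occur in
   consecutive blocks. *)
Fixpoint fits (E : seq T) (bs : seq (seq nat)) (ths : seq (seq T)) : Prop :=
  match bs, ths with
  | [::], [::] => True
  | B :: bs', t :: ths' =>
      [/\ sorted <%O t, size t = size B, mask (map is2 B) t = E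
        & fits (mask (map is1 B) t) bs' ths']
  | _, _ => False
  end.

End Fits.

Lemma fits_map d1 d2 (T : orderType d1) (U : orderType d2) (f : T -> U) E bs ths :
  {in flatten ths &, {homo f : a b / (a < b)%O}} -> fits E bs ths ->
  fits (map f E) bs (map (map f) ths).
Proof.
elim: bs E ths => [|B bs IH] E [|t ths] //= fM [ts tB <- H].
split; rewrite ?size_map ?map_mask //.
- rewrite sorted_map; apply: (sub_in_sorted (P := [in t])) ts; last exact/allP.
  by move=> a b at_ bt; apply: fM; rewrite mem_cat ?at_ ?bt.
- rewrite -map_mask; apply: IH => // a b at_ bt.
  by apply: fM; rewrite mem_cat ?at_ ?bt orbT.
Qed.

(** The entries outside the mask are inserted into the gaps of [E] by density; [a] is the lower
    bound carried along the induction. *)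
Lemma extend_mask (m : bitseq) (a : rat) (E : seq rat) :
  path <%O a E -> size E = count id m ->
  exists t, [/\ path <%O a t, size t = size m & mask m t = E].
Proof.
elim: m a E => [|b m IH] a E aE sE.
  by exists [::]; split=> //; case: E sE {aE}.
case: b sE => /= sE; last first.
  have [c ac cE] : exists2 c, (a < c)%R & path <%O c E.
    case: E aE sE => [_ _|e E /= /andP[ae eE] _].
      by exists (a + 1)%R => //; rewrite ltrDl.
    by exists ((a + e) / 2)%R; rewrite ?eE ?andbT; move: ae => /= ae; lra.
  have [t [ct st mt]] := IH c E cE sE.
  by exists (c :: t); split=> /=; rewrite ?ac ?ct ?st.
case: E aE sE => //= e E /andP[ae eE] [sE].
have [t [et st mt]] := IH e E eE sE.
by exists (e :: t); split=> /=; rewrite ?ae ?et ?st ?mt.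
Qed.

Lemma path_below (E : seq rat) : sorted <%O E -> exists a, path <%O a E.
Proof.
case: E => [|e E] /= sE; first by exists 0%R.
by exists (e - 1)%R; rewrite sE andbT /= gtrBl.
Qed.

Lemma exists_fits_rat (E : seq rat) bs : sorted <%O E ->
  map twos bs = belast (size E) (map ones bs) -> exists ths, fits E bs ths.
Proof.
elim: bs E => [|B bs IH] E sE /=; first by exists [::].
case=> BE bsE; have [a aE] := path_below sE.
have [|t [at_ st mt]] := extend_mask (m := map is2 B) aE.
  by rewrite -twos_count.
have ts : sorted <%O t by exact: path_sorted at_.
rewrite size_map in st.
have mts : size (mask (map is1 B) t) = ones B.
  by rewrite size_mask ?size_map // -ones_count.
have [||ths H] := IH (mask (map is1 B) t).
- by apply: sorted_mask => //; apply: lt_trans.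
- by rewrite mts.
- by exists (t :: ths).
Qed.

(* The offsets are found one block after the other in the dense order [rat] and
   then replaced by their ranks. *)
Lemma exists_fits bs : map twos bs = belast 0 (map ones bs) ->
  exists M (ths : seq (seq nat)),
    fits [::] bs ths /\ all (all (fun e => e < M)) ths.
Proof.
move=> E; have [//|ths H] := @exists_fits_rat [::] bs _ E.
set L := flatten ths; pose r (q : rat) := count (< q)%O L.
exists (size L).+1, (map (map r) ths); split; last first.
  apply/allP => _ /mapP[t _ ->]; apply/allP => _ /mapP[e _ ->].
  by rewrite ltnS count_size.
apply: (@fits_map _ _ _ _ r [::]) H => a b aL bL ab.
(* The rank is strictly increasing because [a] itself is counted in [r b] but not in [r a]. *)
have E1 := count_predUI (< a)%O (pred1 a) L.
have E0 : count (predI (< a)%O (pred1 a)) L = 0.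
  apply/eqP; rewrite -leqn0 leqNgt -has_count; apply/hasPn => c _ /=.
  by apply/negP => /andP[+ /eqP ca]; rewrite ca ltxx.
rewrite E0 addn0 in E1.
apply: (@leq_trans (count (predU (< a)%O (pred1 a)) L)).
  by rewrite E1 -addn1 leq_add2l -has_count has_pred1.
by apply: sub_count => c /= /orP[ca|/eqP->//]; apply: lt_trans ab.
Qed.

(** Block [i] is placed at [M * u_i] plus its offsets; offsets below [M] keep different blocks
    apart. *)
Definition assemble (M : nat) (u : seq nat) (E : seq (seq nat)) : seq nat :=
  flatten [seq [seq M * p.1 + e | e <- p.2] | p <- zip u E].

Lemma assemble_nil M u : assemble M u [::] = [::].
Proof. by case: u. Qed.

Lemma assemble_cons M a u E Es :
  assemble M (a :: u) (E :: Es) = [seq M * a + e | e <- E] ++ assemble M u Es.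
Proof. by []. Qed.

Definition first_parts (bs ths : seq (seq nat)) : seq (seq nat) :=
  [seq mask (map is1 p.1) p.2 | p <- zip bs ths].

(** The shift by [belast] reflects that the [Y]-part of a block has the offsets of the [X]-part of
    the preceding block. *)
Lemma assemble_realizes M E bs ths u : fits E bs ths -> size bs <= size u ->
  realizes (flatten bs) (assemble M u ths) (assemble M u (first_parts bs ths))
    (assemble M u (belast E (first_parts bs ths))).
Proof.
elim: bs E ths u => [|B bs IH] E [|t ths] [|a u] //= [ts tB tE H] ub.
rewrite !assemble_cons; apply: realizes_cat; last exact: IH.
by apply: realizes_map; split.
Qed.

Lemma mem_assemble M u (ths : seq (seq nat)) b :
  all (all (fun e => e < M)) ths -> b \in assemble M u ths ->
  exists2 a, a \in u & M * a <= b < M * a.+1.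
Proof.
elim: u ths => [|a u IH] [|t ths] //= /andP[/allP tM tsM].
rewrite assemble_cons mem_cat => /orP[/mapP[e /tM eM ->]|/IH[//|c cu cb]].
  by exists a; [rewrite inE eqxx | rewrite leq_addr mulnS addnC ltn_add2r].
by exists c; rewrite ?inE ?cu ?orbT.
Qed.

Lemma assemble_sorted M E bs ths u : fits E bs ths ->
  all (all (fun e => e < M)) ths -> sorted ltn u ->
  sorted ltn (assemble M u ths).
Proof.
rewrite !(sorted_pairwise ltn_trans).
elim: bs E ths u => [|B bs IH] E [|t ths] [|a u] //= [ts tB tE H].
move=> /andP[tM tsM] /andP[/allP au us].
rewrite assemble_cons pairwise_cat (IH _ _ _ H) // andbT.
rewrite pairwise_map; apply/andP; split.
  apply/allrelP => _ c /mapP[e et ->] /(mem_assemble tsM)[b bu /andP[bc _]].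
  apply: leq_trans bc; apply: (@leq_trans (M * a.+1)).
    by rewrite mulnS addnC ltn_add2r (allP tM).
  by rewrite leq_mul2l au ?orbT.
have : pairwise ltn t by rewrite -(sorted_pairwise ltn_trans).
by apply: sub_pairwise => e e' /=; rewrite ltn_add2l.
Qed.

(* [V (take d u)] and [V (behead u)] are the images of two adjacent vertices of
   the shift graph on [d]-tuples. *)
Definition shift_gadget (d : nat) (s : seq nat) : Prop :=
  exists M, forall N, exists V : seq nat -> seq nat, forall u,
    size u = d.+1 -> sorted ltn u -> all (fun a => a < N) u ->
    exists z, [/\ sorted ltn z, all (fun a => a < M * N) z
                & realizes s z (V (take d u)) (V (behead u))].

Lemma shift_gadget_nil d : shift_gadget d [::].
Proof. by exists 0 => N; exists (fun=> [::]) => u _ _ _; exists [::]; split. Qed.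

Lemma shift_gadget_trivial d : shift_gadget d [:: 3].
Proof.
exists 1 => N; exists (fun=> [:: 0]) => -[|a u] // _ _ /= /andP[aN _].
by exists [:: 0]; split=> //=; rewrite mul1n andbT; lia.
Qed.

(** The second gadget is translated by [M1 * N], beyond the range of the first. *)
Lemma shift_gadget_cat d s1 s2 :
  shift_gadget d s1 -> shift_gadget d s2 -> shift_gadget d (s1 ++ s2).
Proof.
move=> [M1 G1] [M2 G2]; exists (M1 + M2) => N.
have [V1 H1] := G1 N; have [V2 H2] := G2 N.
exists (fun v => V1 v ++ map (addn (M1 * N)) (V2 v)) => u us uS uN.
have [z1 [s1' b1 r1]] := H1 u us uS uN; have [z2 [s2' b2 r2]] := H2 u us uS uN.
exists (z1 ++ map (addn (M1 * N)) z2); split.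
- move: s1' s2'; rewrite !(sorted_pairwise ltn_trans) pairwise_cat => -> s2'.
  rewrite pairwise_map; apply/andP; split.
    apply/allrelP => a _ /(allP b1) aN /mapP[b _ ->] /=.
    exact: leq_trans (leq_addr _ _).
  by apply: sub_pairwise s2' => e e' /=; rewrite ltn_add2l.
- rewrite all_cat; apply/andP; split.
    by apply: sub_all b1 => a /= aN; rewrite mulnDl; lia.
  rewrite all_map; apply: sub_all b2 => a /= aN; rewrite mulnDl; lia.
- exact/realizes_cat/realizes_map.
Qed.

(** Reflecting the tuple reverses the direction of the shift and so exchanges its two ends. The
    reflection is one reason why [V] may depend on [N]. *)
Lemma shift_gadget_swap d s : all [in [:: 1; 2; 3]] s ->
  shift_gadget d (map swap12 s) -> shift_gadget d s.
Proof.
move=> s123 [M G]; exists M => N; have [V H] := G N.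
pose c a := N.-1 - a.
exists (fun v => V (map c (rev v))) => u us uS /allP uN.
have [|||z [zs zN r]] := H (map c (rev u)).
- by rewrite size_map size_rev.
- rewrite sorted_map; have : sorted gtn (rev u) by rewrite rev_sorted.
  apply: (sub_in_sorted (P := [in u])); last by apply/allP => a; rewrite mem_rev.
  by move=> a b /uN aN /uN bN /=; rewrite /c; lia.
- apply/allP => _ /mapP[a + ->]; rewrite mem_rev => /uN; rewrite /c; lia.
exists z; split=> //; move: r => /(realizes_swap _ _ _ s123).
rewrite -map_take behead_map.
have -> : take d (rev u) = rev (behead u).
  by rewrite take_rev us subSnn drop1.
have -> // : behead (rev u) = rev (take d u).
by rewrite -drop1 drop_rev us subn1.
Qed.

Lemma size_first_parts d (T : orderType d) (E : seq T) bs ths : fits E bs ths ->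
  map size [seq mask (map is1 p.1) p.2 | p <- zip bs ths] = map ones bs.
Proof.
elim: bs E ths => [|B bs IH] E [|t ths] //= [_ tB _ H].
by rewrite (IH _ _ H) size_mask ?size_map // -ones_count.
Qed.

Lemma assemble_rcons_nil M u Es :
  assemble M u (rcons Es [::]) = assemble M u Es.
Proof.
elim: Es u => [|E Es IH] [|a u] //=; first by case: u.
by rewrite !assemble_cons IH.
Qed.

Lemma assemble_take M u Es n : size Es <= n ->
  assemble M (take n u) Es = assemble M u Es.
Proof.
elim: Es u n => [|E Es IH] [|a u] [|n] //=.
by rewrite ltnS => En; rewrite !assemble_cons IH.
Qed.

Lemma shift_gadget_blocks d s bs : block_chain s bs -> size bs <= d.+1 ->
  shift_gadget d s.
Proof.
move=> [<- tw la _] sb; have [M [ths [H thsM]]] := exists_fits tw.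
exists M => N; set Es := first_parts bs ths.
have szE : map size Es = map ones bs := size_first_parts H.
exists (fun v => assemble M v (take (size bs).-1 Es)) => u us uS /allP uN.
exists (assemble M u ths); split.
- exact: assemble_sorted H thsM uS.
- apply/allP => b /(mem_assemble thsM)[a /uN aN /andP[_ ba]].
  by apply: leq_trans ba _; rewrite leq_mul2l aN orbT.
have [zs zx zy] : realizes (flatten bs) (assemble M u ths) (assemble M u Es)
    (assemble M u (belast [::] Es)).
  by apply: assemble_realizes => //; rewrite us.
have sE : size Es = size bs by rewrite -(size_map size) szE size_map.
have lE : last 0 (map size Es) = 0 by rewrite szE.
split=> //; rewrite ?zx ?zy {zs zx zy szE}; clearbody Es;
  case: (lastP Es) lE sE => [|Es' E].
- by move=> _ _; rewrite !assemble_nil.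
- rewrite map_rcons last_rcons size_rcons => /size0nil -> sE; rewrite -sE /=.
  rewrite assemble_rcons_nil -cats1 take_size_cat // assemble_take //.
  by rewrite -ltnS sE.
- by move=> _ _; rewrite !assemble_nil.
- rewrite map_rcons last_rcons size_rcons => /size0nil -> <- /=.
  rewrite belast_rcons -cats1 take_size_cat //.
  by case: (u) us.
Qed.

(** Colour a shorter tuple by the set [F'] of colours of its extensions by a larger last entry. If
    both ends of [u] had the same set, [F u] would be the colour of an extension of [behead u] by
    some [b'], so [rcons u b'] would violate the hypothesis. *)
Lemma shift_colors e N (C : finType) (F : seq nat -> C) :
  (forall u, size u = e.+2 -> sorted ltn u -> all (fun a => a < N) u ->
     F (take e.+1 u) <> F (behead u)) ->
  N <= iter e (expn 2) #|C|.
Proof.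
elim: e C F => [|e IH] C F H.
  have inj : injective (fun i : 'I_N => F [:: nat_of_ord i]).
    move=> i j E; apply: val_inj; case: (ltngtP i j) => // ij; exfalso.
      by apply: (H [:: nat_of_ord i; nat_of_ord j]) => //=; rewrite ?ij ?ltn_ord.
    by apply: (H [:: nat_of_ord j; nat_of_ord i]) => //=; rewrite ?ij ?ltn_ord.
  by have := leq_card _ inj; rewrite card_ord.
rewrite iterSr.
pose F' u := [set F (rcons u (nat_of_ord b)) | b : 'I_N & last 0 u < b].
have := IH {set C} F'; rewrite -cardsT -powersetT card_powerset cardsT.
apply=> u us uS uN E.
have [v [b uE]] : exists v b, u = rcons v b.
  by case: (lastP u) us => // v b _; exists v, b.
have sv : size v = e.+1 by move: us; rewrite uE size_rcons => -[].
have : F u \in F' (take e.+1 u).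
  move: uS uN; rewrite uE -sv -cats1 take_size_cat // cats1.
  rewrite all_rcons => vS /andP[bN _].
  apply/imsetP; exists (Ordinal bN) => //; rewrite inE /=.
  by move: vS; case: (v) sv => //= c v' _; rewrite rcons_path => /andP[].
rewrite E => /imsetP[b']; rewrite inE => lb Eb.
have sr : size (rcons u b') = e.+3 by rewrite size_rcons us.
apply: (H (rcons u b') sr).
- case: (u) us uS lb => [|c [|c' w]] //= _ /andP[-> cw] lb.
  by rewrite rcons_path cw.
- by rewrite all_rcons uN ltn_ord.
- rewrite -us -cats1 take_size_cat // Eb.
  by case: (u) us => //= c w _; rewrite cats1.
Qed.

(** * Bounds on the chromatic number *)

Lemma irreducible_cases s : irreducible_type s ->
  [\/ primary_word s /\ nblocks s = size (primary_blocks s),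
      primary_word (map swap12 s)
      /\ nblocks s = size (primary_blocks (map swap12 s))
    | s = [:: 3]].
Proof.
move=> irr; have [/andP[s123 _] ne] := irreducible_prefix irr.
case: s irr s123 ne => [[_ //]|c s] irr /= /andP[].
rewrite !inE => /or3P[]/eqP cE s123 ne.
- by apply: Or31; split; [exact: (primary_irreducible irr) | rewrite cE].
- apply: Or32; split; first exact: (secondary_irreducible irr).
  by rewrite cE /nblocks /= size_map.
(* The prefix [[:: 3]] is balanced, so it must be the whole word. *)
- apply: Or33; rewrite cE; case: s ne {irr s123} => // a s /(_ 1 isT) [].
  by rewrite cE.
Qed.

Lemma irreducible_letters s : irreducible_type s -> all [in [:: 1; 2; 3]] s.
Proof. by case/irreducible_prefix => /andP[]. Qed.

Lemma shift_gadget_irreducible d s : irreducible_type s -> nblocks s <= d.+1 ->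
  shift_gadget d s.
Proof.
move=> irr; case: (irreducible_cases irr) => [[pw ->]|[pw ->]|-> _].
- by have [bc _] := primary_block_chain pw; apply: shift_gadget_blocks bc.
- have [bc _] := primary_block_chain pw => sb.
  apply: shift_gadget_swap; first exact: irreducible_letters.
  exact: shift_gadget_blocks bc sb.
- exact: shift_gadget_trivial.
Qed.

Lemma shift_gadget_factors d rhos :
  (forall rho, rho \in rhos -> irreducible_type rho) ->
  (forall rho, rho \in rhos -> nblocks rho <= d.+1) ->
  shift_gadget d (flatten rhos).
Proof.
elim: rhos => [|rho rhos IH] irr nb /=; first exact: shift_gadget_nil.
apply: shift_gadget_cat.
  by apply: shift_gadget_irreducible; [apply: irr | apply: nb]; rewrite mem_head.
by apply: IH => r rin; [apply: irr | apply: nb]; rewrite inE rin orbT.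
Qed.

Lemma chromatic_numberP (G : sgraph) : colorable G (chromatic_number G).
Proof. by rewrite /chromatic_number; case: ex_minnP. Qed.

Lemma chromatic_number_le (G : sgraph) (C : finType) (f : G -> C) :
  (forall x y : G, adj x y -> f x <> f y) -> chromatic_number G <= #|C|.
Proof.
move=> fP; rewrite /chromatic_number; case: ex_minnP => c _; apply.
apply/existsP; exists [ffun x => enum_rank (f x)].
apply/forallP => x; apply/forallP => y; apply/implyP => /fP xy.
by rewrite !ffunE; apply/eqP => /enum_rank_inj.
Qed.

Lemma mem_ksubsets n k (A : {fset nat}) :
  (A \in ksubsets n k) = all [in iota 1 n] A && (#|` A| == k).
Proof.
rewrite !inE /= fpowersetE; congr (_ && _).
apply/fsubsetP/allP => H a /H; rewrite in_fset //.
Qed.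

Lemma chromatic_lower k l tau (tauN : ~~ trivial_type tau) e :
  is_type_of k l tau -> shift_gadget e.+1 tau ->
  exists M, forall n, n %/ M.+1
    <= iter e (expn 2) (chromatic_number (type_graph n k tauN)).+1.
Proof.
move=> /is_type_word[/andP[t123 /eqP t12] tk] [M G]; exists M => n.
(* Values below [M * (n %/ M.+1)] fit into [[1, n]] after adding one; [M.+1] keeps the divisor
   positive. *)
set c := chromatic_number _; have [V H] := G (n %/ M.+1).
have /existsP[f /forallP fP] : colorable (type_graph n k tauN) c.
  exact: chromatic_numberP.
pose A v := [fset a in map S (V v)]%fset.
(* Only the values of [V] on ends of increasing [e+2]-tuples are vertices. *)
pose F v := omap f (insub (A v) : option (ksubsets n k)).
(* The value [None], taken off the vertices, costs one extra colour. *)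
have -> : c.+1 = #|{: option 'I_c}| by rewrite card_option card_ord.
apply: (@shift_colors e _ _ F) => u us uS uN.
have [z [zs /allP zN r]] := H u us uS uN.
have Sz : sorted ltn (map S z) by rewrite sorted_map.
have rS := realizes_map S r; have [sx sy] := realizes_size rS.
have bd b : b \in map S z -> b \in iota 1 n.
  case/mapP => a /zN az ->; rewrite mem_iota add1n !ltnS /=.
  apply: leq_trans az _; apply: leq_trans (leq_divM n M.+1).
  by rewrite mulnC leq_mul2l leqnSn orbT.
have inK v m : sorted ltn (map S (V v)) -> map S (V v) = mask m (map S z) ->
    size (map S (V v)) = k -> A v \in ksubsets n k.
  move=> vS vE vk; rewrite mem_ksubsets card_fset_sorted // vk eqxx andbT.
  apply/allP => b; rewrite in_fset /= vE => /mem_mask; exact: bd.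
case: (rS) => sz xE yE.
have s1 : sorted ltn (map S (V (take e.+1 u))).
  by rewrite -xE; apply: sorted_mask => //; exact: ltn_trans.
have s2 : sorted ltn (map S (V (behead u))).
  by rewrite -yE; apply: sorted_mask => //; exact: ltn_trans.
have k1 : A (take e.+1 u) \in ksubsets n k by apply: inK (esym xE) _; rewrite ?sx.
have k2 : A (behead u) \in ksubsets n k.
  by apply: inK (esym yE) _; rewrite ?sy -?t12.
rewrite /F; case: insubP => [X _ XE|]; last by rewrite k1.
case: insubP => [Y _ YE|]; last by rewrite k2.
move=> [] /= fXY; have := implyP (forallP (fP X) Y); rewrite fXY eqxx => H'.
suff /H' : type_adj tau X Y by [].
by apply/orP; left; rewrite XE YE; apply/eqP/(order_type_fset _ t123 rS).
Qed.

Lemma chain_edge_of_realizes m n bs rho (z x y : seq nat) :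
  primary_word rho -> block_chain rho bs -> size bs = m.+2 ->
  sorted ltn z -> realizes rho z x y -> all (leq^~ n) x -> all (leq^~ n) y ->
  [/\ bounded_chain (block_start bs m) n.+1 (nth 0 x),
      bounded_chain (block_start bs m) n.+1 (nth 0 y)
    & chain_edge m (block_start bs m) (block_start bs) (nth 0 x) (nth 0 y)].
Proof.
move=> pw bc sb zs r /allP xn /allP yn.
have [sx sy] := realizes_size r; have Tk := block_start_lt bc sb.
have E : ones rho = twos rho by case: pw => /andP[_ /eqP].
have [_ xE yE] := r.
have chain w : sorted ltn w -> size w = ones rho -> {in w, forall a, a <= n} ->
    bounded_chain (block_start bs m) n.+1 (nth 0 w).
  move=> ws sw wn; split=> [j jT|]; last by rewrite ltnS wn // mem_nth // sw.
  apply: ltnW; apply: (sorted_ltn_nth ltn_trans 0 ws) => //; rewrite inE sw; lia.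
split.
- by apply: chain => //; rewrite -xE; apply: sorted_mask => //; exact: ltn_trans.
- apply: chain => //; last by rewrite sy.
  by rewrite -yE; apply: sorted_mask => //; exact: ltn_trans.
- exact: (@realizes_chain_edge _ _ 0 rho bs m z x y id).
Qed.

(** As [pre] is balanced, [rho] occupies the same index range in [X] and in [Y], so [part] depends
    on a single vertex. A secondary factor exchanges [X] and [Y], which is harmless because
    adjacency is symmetric. *)
Lemma chromatic_upper k tau (tauN : ~~ trivial_type tau) pre rho post m :
  tau = pre ++ rho ++ post -> type_word pre ->
  irreducible_type rho -> nblocks rho = m.+2 ->
  exists K, forall n, chromatic_number (type_graph n k tauN)
    <= K ^ m * (iter m (fun a => (up_log 2 a).+1) n.+1).+1.
Proof.
move=> tauE /andP[_ /eqP pre12] irr nb.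
have r123 := irreducible_letters irr.
have [rho' [pw nb' rE]] : exists rho', [/\ primary_word rho',
    size (primary_blocks rho') = m.+2
    & rho' = rho \/ rho' = map swap12 rho].
  case: (irreducible_cases irr) => [[pw E]|[pw E]|E]; last by rewrite E in nb.
    by exists rho; rewrite -E; split=> //; left.
  by exists (map swap12 rho); rewrite -E; split=> //; right.
have [bc _] := primary_block_chain pw.
set bs := primary_blocks rho' in bc nb'.
have Tk := block_start_lt bc nb'.
exists (2 ^ (size rho').*2.+1) => n.
have [||i im||C [f [cC fP]]] := @chain_coloring (size rho') m (block_start bs m)
  n.+1 (block_start bs).
- by rewrite /block_start take0.
- by [].
- exact: block_start_mono.
- by apply: leq_trans (ltnW Tk) _; exact: count_size.
apply: leq_trans cC.
pose part (X : {fset nat}) := take (ones rho) (drop (ones pre) (sort <=%O X)).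
apply: (@chromatic_number_le (type_graph n k tauN) C
  (fun X : ksubsets n k => f (nth 0 (part (val X))))).
have part_le (X : ksubsets n k) : all (leq^~ n) (part (val X)).
  apply/allP => a /mem_take/mem_drop; rewrite mem_sort.
  have := valP X; rewrite mem_ksubsets => /andP[/allP H _] /H.
  by rewrite mem_iota; lia.
suff edge (X Y : ksubsets n k) : order_type (val X) (val Y) = tau ->
    f (nth 0 (part (val X))) <> f (nth 0 (part (val Y))).
  move=> X Y /orP[] /eqP; first exact: edge.
  by move=> /edge H E; apply: H.
have rho12 : ones rho = twos rho.
  by case/irreducible_prefix: irr => /andP[_ /eqP].
have [z zs [_ r]] := order_type_realizes (val X) (val Y).
move=> XY; move: r; rewrite XY tauE => /realizes_take[_] /realizes_take[r _].
rewrite -pre12 -rho12 in r; rewrite -/(part (val X)) -/(part (val Y)) in r.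
set w := take _ _ in r.
have ws : sorted ltn w by apply/take_sorted/drop_sorted.
case: rE => rE.
  rewrite -rE in r.
  have [c1 c2 ce] := chain_edge_of_realizes pw bc nb' ws r (part_le X) (part_le Y).
  exact: fP.
have r' := (realizes_swap _ _ _ r123).2 r; rewrite -rE in r'.
have [c1 c2 ce] := chain_edge_of_realizes pw bc nb' ws r' (part_le Y) (part_le X).
by move=> /esym; apply: fP.
Qed.

(** * Iterated logarithms *)

Local Open Scope classical_set_scope.
Local Open Scope ring_scope.

Section IterLog.
Variable R : realType.
Implicit Types x y : R.

Lemma ln2_gt0 : 0 < ln (2 : R).
Proof. by rewrite ln_gt0 // ltr1n. Qed.

Lemma log2_mono x y : 0 < x -> x <= y -> log2 x <= log2 y.
Proof.
move=> x0 xy; rewrite /log2 ler_pM2r ?invr_gt0 ?ln2_gt0 // ler_ln // posrE.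
exact: lt_le_trans xy.
Qed.

Lemma log2M x y : 0 < x -> 0 < y -> log2 (x * y) = log2 x + log2 y.
Proof. by move=> x0 y0; rewrite /log2 lnM ?posrE // mulrDl. Qed.

Lemma log2_exp2 a : log2 (2 ^+ a : R) = a%:R.
Proof.
by rewrite /log2 lnXn // -(mulr_natl (ln 2)) mulfK // gt_eqF // ln2_gt0.
Qed.

Lemma iter_logS t x : iter_log t.+1 x = log2 (iter_log t x).
Proof. by []. Qed.

Lemma up_log2_le g : (0 < g)%N -> (up_log 2 g)%:R <= log2 (g%:R : R) + 1.
Proof.
move=> g0; case: (ltnP 1 g) => g1; last first.
  have -> : g = 1%N by lia.
  by rewrite up_log1 /log2 ln1 mul0r add0r.
have /andP[lo _] := up_log_bounds (ltnSn 1) g1.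
have u0 : (0 < up_log 2 g)%N by rewrite up_log_gt0.
rewrite -(prednK u0) -natr1 lerD2r -(log2_exp2 (up_log 2 g).-1).
apply: log2_mono; first exact: exprn_gt0.
by rewrite -natrX ler_nat ltnW.
Qed.

Lemma iter_log_large t (A : R) : \forall n \near \oo, A <= iter_log t (n%:R : R).
Proof.
elim: t A => [|t IH] A; first exact: nbhs_infty_ger.
near=> n; have : expR (A * ln 2) <= iter_log t (n%:R : R) by near: n; apply: IH.
rewrite iter_logS => h.
rewrite /log2 ler_pdivlMr ?ln2_gt0 // -[A * _]expRK ler_ln ?posrE ?expR_gt0 //.
exact: lt_le_trans (expR_gt0 _) h.
Unshelve. all: end_near. Qed.

(** The threshold is uniform in [a], since [a] will be a multiple of a chromatic number that depends
    on [n]. *)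
Lemma iter_log_tower m : \forall n \near \oo, forall a,
  (n <= iter m (expn 2) a)%N -> iter_log m (n%:R : R) <= a%:R.
Proof.
elim: m => [|m IH]; first by near=> n => a /=; rewrite ler_nat.
near=> n.
have le b : (n <= iter m (expn 2) b)%N -> iter_log m (n%:R : R) <= b%:R.
  by move: b; near: n.
move=> a; rewrite iterSr => /le h.
rewrite iter_logS -(log2_exp2 a) -natrX.
apply: log2_mono => //; apply: (lt_le_trans ltr01).
by near: n; apply: iter_log_large.
Unshelve. all: end_near. Qed.

Lemma iter_up_log_le m : exists2 K : R, 0 < K & \forall n \near \oo,
  (iter m (fun a => (up_log 2 a).+1) n.+1)%:R <= K * iter_log m (n%:R : R).
Proof.
elim: m => [|m [K K0 IH]].
  exists 2 => //; near=> n => /=; rewrite /iter_log /= -natrM ler_nat.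
  suff : (1 <= n)%N by lia.
  by near: n; apply: nbhs_infty_ge.
(* Once [log2 K + 2 <= log2 L], the bound [log2 K + log2 L + 2] is at most [2 * log2 L]. *)
exists 2 => //; near=> n.
have L1 : 1 <= iter_log m (n%:R : R) by near: n; apply: iter_log_large.
have gL : (iter m (fun a => (up_log 2 a).+1) n.+1)%:R
    <= K * iter_log m (n%:R : R) by near: n.
have large : log2 K + 2 <= iter_log m.+1 (n%:R : R).
  by near: n; apply: iter_log_large.
rewrite iter_logS in large *; rewrite iterS.
have g0 : (0 < iter m (fun a => (up_log 2 a).+1) n.+1)%N by case: (m).
set g := iter m _ _ in gL g0 *; set L := iter_log m _ in L1 gL large *.
have L0 : 0 < L by exact: lt_le_trans L1.
have := up_log2_le g0.
have : log2 (g%:R : R) <= log2 K + log2 L.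
  by rewrite -log2M //; apply: log2_mono => //; rewrite ltr0n.
rewrite -natr1; lra.
Unshelve. all: end_near. Qed.

End IterLog.

Lemma tower_gt0 e c : (0 < c)%N -> (0 < iter e (expn 2) c)%N.
Proof. by case: e => //= e _; rewrite expn_gt0. Qed.

(** A factor outside the tower is absorbed into its argument, since [K * 2 ^ t <= 2 ^ (K.+1 * t)]
    for [t > 0]. This handles the division by [M.+1] in the lower bound. *)
Lemma tower_scale e K : exists K', forall c, (0 < c)%N ->
  (K * iter e (expn 2) c <= iter e (expn 2) (K' * c))%N.
Proof.
elim: e K => [|e IH] K; first by exists K.
have [K' H] := IH K.+1; exists K' => c c0; rewrite !iterS.
have t0 := tower_gt0 e c0; set t := iter e _ c in t0 H *.
apply: (@leq_trans (2 ^ (K.+1 * t))); last by rewrite leq_exp2l // H.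
rewrite mulSn expnD mulnC leq_mul2l; apply/orP; right.
by apply: (leq_trans (ltnW (ltn_expl K (ltnSn 1)))); rewrite leq_exp2l // leq_pmulr.
Qed.

Lemma max_nblocks_attained rhos : (0 < \max_(rho <- rhos) nblocks rho)%N ->
  exists2 rho, rho \in rhos & nblocks rho = (\max_(rho <- rhos) nblocks rho)%N.
Proof.
elim: rhos => [|r rhos IH]; first by rewrite big_nil.
rewrite big_cons; case: (leqP (nblocks r) (\max_(rho <- rhos) nblocks rho)) => h.
  by move=> /IH[rho rin E]; exists rho; rewrite ?inE ?rin ?orbT.
by move=> _; exists r; rewrite ?mem_head.
Qed.

(** Primary words have at least two blocks, so otherwise all factors would be [[:: 3]]. Hence the
    subtraction of 2 in the theorem is not truncated. *)
Lemma nontrivial_max_nblocks rhos :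
  (forall rho, rho \in rhos -> irreducible_type rho) ->
  ~~ trivial_type (flatten rhos) -> (1 < \max_(rho <- rhos) nblocks rho)%N.
Proof.
move=> irr; apply: contraR; rewrite -leqNgt => mx.
apply/allP => a /flattenP[rho rin ain].
have nb : (nblocks rho <= 1)%N by apply: leq_trans mx; apply: leq_bigmax_seq.
case: (irreducible_cases (irr _ rin)) => [[pw E]|[pw E]|E].
- by have [_] := primary_block_chain pw; rewrite -E; lia.
- by have [_] := primary_block_chain pw; rewrite -E; lia.
- by move: ain; rewrite E inE.
Qed.

Lemma type_word_flatten rhos :
  (forall rho, rho \in rhos -> irreducible_type rho) -> type_word (flatten rhos).
Proof.
elim: rhos => [|r rhos IH] irr //=.
have /andP[a1 /eqP e1] := (irreducible_prefix (irr r (mem_head _ _))).1.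
have /andP[a2 /eqP e2] : type_word (flatten rhos).
  by apply: IH => rho rin; apply: irr; rewrite inE rin orbT.
by rewrite /type_word all_cat a1 a2 ones_cat twos_cat e1 e2 /=.
Qed.

Unset Implicit Arguments.

Theorem theorem1p8 (R : realType) (k l : nat) (tau : seq nat)
    (tau_type : is_type_of k l tau) (tau_nontrivial : ~~ trivial_type tau)
    (rhos : seq (seq nat))
    (rhos_irr : forall rho, rho \in rhos -> irreducible_type rho)
    (tau_fact : tau = flatten rhos) :
  (fun n : nat => (chromatic_number (type_graph n k tau_nontrivial))%:R : R)
    \is 'Theta_\oo (fun n : nat =>
      iter_log ((\max_(rho <- rhos) nblocks rho) - 2)%N n%:R : R).
Proof.
set m := (_ - 2)%N.
have mx : (\max_(rho <- rhos) nblocks rho)%N = m.+2.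
  have := nontrivial_max_nblocks rhos_irr; rewrite -tau_fact.
  by move=> /(_ tau_nontrivial) /subnK <-; rewrite addn2.
have [K upper] : exists K, forall n,
    (chromatic_number (type_graph n k tau_nontrivial) <= K ^ m * (iter m (fun a => (up_log 2 a).+1) n.+1).+1)%N.
  have [|rho rin rb] := @max_nblocks_attained rhos; first by rewrite mx.
  move: rb; rewrite mx => rb.
  have [r1 [r2 rE]] : exists r1 r2, rhos = r1 ++ rho :: r2.
    by case/splitPr: rin => r1 r2; exists r1, r2.
  apply: (@chromatic_upper k tau tau_nontrivial (flatten r1) rho (flatten r2)) => //.
  - by rewrite tau_fact rE flatten_cat.
  - apply: type_word_flatten => r' r'in; apply: rhos_irr.
    by rewrite rE mem_cat r'in.
  - exact: rhos_irr.
have [M lower] : exists M, forall n, (n %/ M.+1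
    <= iter m (expn 2) (chromatic_number (type_graph n k tau_nontrivial)).+1)%N.
  apply: (chromatic_lower tau_nontrivial tau_type).
  rewrite tau_fact; apply: shift_gadget_factors => // rho rin.
  by rewrite -mx leq_bigmax_seq.
have [K1 K10 up] := iter_up_log_le R m.
have [K2 scale] := tower_scale m (2 * M.+1).
(* The two summands 1 keep both constants positive. *)
apply/asboolP; exists ((2 * K2 + 1)%:R^-1, 2 * K%:R ^+ m * K1 + 1) => /=.
  by rewrite invr_gt0 ltr0n addn1 /= ltr_wpDl // !mulr_ge0 ?exprn_ge0 ?ler0n // ltW.
near=> n.
have L1 : (2 * K2 + 1)%:R <= iter_log m (n%:R : R).
  by near: n; apply: iter_log_large.
have tower a : (n <= iter m (expn 2) a)%N -> iter_log m (n%:R : R) <= a%:R.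
  by move: a; near: n; apply: iter_log_tower.
have gL : (iter m (fun a => (up_log 2 a).+1) n.+1)%:R
    <= K1 * iter_log m (n%:R : R) by near: n.
set c := chromatic_number _; set L := iter_log m _ in L1 tower gL *.
have L0 : 0 <= L by apply: le_trans L1; rewrite ler0n.
rewrite !ger0_norm ?ler0n //; split.
  have Lc : L <= (K2 * c.+1)%:R.
    (* From [n %/ M.+1 <= t] and [t > 0] follows [n <= 2 * M.+1 * t], which explains the factor
       given to [tower_scale]. *)
    apply: tower; apply: leq_trans (scale _ (ltn0Sn c)).
    have := lower n; rewrite -/c; set t := iter m _ _ => nt.
    have t0 : (0 < t)%N by apply: tower_gt0.
    have := divn_eq n M.+1; have := ltn_pmod n (ltn0Sn M); nia.
  (* For [c = 0] one would get [2 * K2 + 1 <= L <= K2]. *)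
  have c1 : (0 < c)%N.
    have := le_trans L1 Lc; rewrite ler_nat; case: (c) => //; lia.
  rewrite ler_pdivrMl ?ltr0n ?addn1 //; apply: le_trans Lc _.
  by rewrite -natrM ler_nat; nia.
have := upper n; rewrite -/c; set g := iter m _ _ in gL * => cg.
have g0 : (0 < g)%N by rewrite /g; case: (m).
have : c%:R <= (2 * K ^ m * g)%:R :> R.
  by rewrite ler_nat; apply: leq_trans cg _; nia.
rewrite !natrM natrX => /le_trans; apply.
rewrite [leRHS]mulrDl mul1r; apply: (@le_trans _ _ (2 * K%:R ^+ m * K1 * L)).
  by rewrite -[leRHS]mulrA; apply: ler_wpM2l gL; rewrite mulr_ge0 ?exprn_ge0 ?ler0n.
by rewrite lerDl.
Unshelve. all: end_near. Qed.
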